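(* Assume $\Omega$ is compact and let $f$ and $\widetilde f$ be two left interval-specifications on $(\Omega,\mathcal{F})$, with $f$ continuous and with a unique consistent measure. Assume also that for each $i\in\mathbb{Z}$ there exists a measurable function $b_i$ on $\Omega$ such that $$\Bigl\|\overset{\circ}{f}_{\{i\}}(\,\cdot\mid\omega)-\overset{\circ}{\widetilde f}_{\{i\}}(\,\cdot\mid\omega)\Bigr\|_d\;\le\;b_i(\omega)$$ for every configuration $\omega$ (the left-hand side depends only on $\omega_{-\infty}^{i-1}\in\Omega_{-\infty}^{i-1}$). Then, for all $\mu\in\mathcal{G}(f)$, $\widetilde\mu\in\mathcal{G}(\widetilde f)$ and $\Lambda\in\mathcal{S}_b$, $$\bigl|\mu(h)-\widetilde\mu(h)\bigr|\;\le\;\sum_{k\in\Lambda\cup\Lambda_-}\widetilde\mu(b_k)\,\delta_k^d\bigl(f_{[k+1,m_\Lambda]}h\bigr)$$ for every $h\in\mathcal{B}_d(\Lambda)$.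
   Context: Let $E$ be a set with a bounded distance $d$ and $\mathcal{E}$ its Borel $\sigma$-algebra. Let $\Omega\subset E^{\mathbb{Z}}$ be a set of (admissible) configurations, endowed with the restriction of the product topology and with the restriction $\mathcal{F}$ of the product $\sigma$-algebra. For $\Lambda\subset\mathbb{Z}$, $\Omega_\Lambda=\{\sigma_\Lambda\in E^\Lambda:\exists\,\omega\in\Omega\text{ with }\omega_\Lambda=\sigma_\Lambda\}$, where $\omega_\Lambda=(\omega_i)_{i\in\Lambda}$; $\Omega_{-\infty}^{i}=\Omega_{]-\infty,i]}$ and $\omega_{-\infty}^{i}=\omega_{]-\infty,i]}$; $\mathcal{F}_\Lambda\subset\mathcal{F}$ is the $\sigma$-algebra generated by the cylinders with base in $\Omega_\Lambda$; $\mathcal{F}_{\le n}=\mathcal{F}_{]-\infty,n]}$. $\mathcal{S}_b$ is the set of finite intervals of $\mathbb{Z}$; for $\Lambda\in\mathcal{S}_b$, $l_\Lambda=\min\Lambda$, $m_\Lambda=\max\Lambda$, $\Lambda_-=\,]-\infty,l_\Lambda-1]$. A left interval-specification (LIS) on $(\Omega,\mathcal{F})$ is a family $f=\{f_\Lambda\}_{\Lambda\in\mathcal{S}_b}$ of probability kernels $f_\Lambda:\mathcal{F}_{\le m_\Lambda}\times\Omega\to[0,1]$ such that for all $\Lambda\in\mathcal{S}_b$: (a) for each $A\in\mathcal{F}_{\le m_\Lambda}$, $f_\Lambda(A\mid\cdot)$ is $\mathcal{F}_{\Lambda_-}$-measurable; (b) for each $B\in\mathcal{F}_{\Lambda_-}$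 and $\omega\in\Omega$, $f_\Lambda(B\mid\omega)=\mathbf{1}_B(\omega)$; (c) for each $\Delta\in\mathcal{S}_b$ with $\Delta\supset\Lambda$, $f_\Delta f_\Lambda=f_\Delta$ on $\mathcal{F}_{\le m_\Lambda}$, i.e. $\int\!\int h(\xi)f_\Lambda(d\xi\mid\sigma)f_\Delta(d\sigma\mid\omega)=\int h(\sigma)f_\Delta(d\sigma\mid\omega)$ for each $\mathcal{F}_{\le m_\Lambda}$-measurable $h$ and each $\omega\in\Omega$. We write $(f_\Lambda h)(\omega)=\int h(\sigma)f_\Lambda(d\sigma\mid\omega)$, and $f_{[m+1,m]}h=h$. The LIS is continuous if $\Omega\ni\omega\mapsto f_\Lambda(A\mid\omega)$ is continuous for all $\Lambda\in\mathcal{S}_b$ and $A\in\mathcal{F}_\Lambda$. A probability measure $\mu$ on $(\Omega,\mathcal{F})$ is consistent with $f$ if $\mu f_\Lambda=\mu$ on $\mathcal{F}_{\le m_\Lambda}$ for every $\Lambda\in\mathcal{S}_b$, where $(\mu f_\Lambda)(A)=\int f_\Lambda(A\mid\omega)\mu(d\omega)$; $\mathcal{G}(f)$ is the set of such measures, and $\mu(h)=\int h\,d\mu$. For an $\mathcal{F}_{\le i}$-measurable function $h$ and $j\le i$, the $d$-oscillation of $h$ with respect to the site $j$ is $$\delta_j^d(h)=\sup\Bigl\{\tfrac{|h(\xi)-h(\eta)|}{d(\xi_j,\eta_j)}:\xi,\eta\in\Omega_{-\infty}^{i},\ \xi_k=\eta_k\ \forall k\ne j\Bigr\},\qquad 0/0=0.$$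 $\mathcal{B}_d$ is the set of $\mathcal{F}$-measurable $h$ with $\sup_{j\in\mathbb{Z}}\delta^d_j(h)<\infty$, and $\mathcal{B}_d(\Lambda)$ the set of $\mathcal{F}_\Lambda$-measurable $h\in\mathcal{B}_d$. $\overset{\circ}{f}_{\{i\}}(\cdot\mid\omega)$ is the projection of $f_{\{i\}}(\cdot\mid\omega)$ over $\Omega_{\{i\}}$, i.e. the law of $\sigma_i$ under $f_{\{i\}}(d\sigma\mid\omega)$ (and likewise for $\widetilde f$). For probability measures $p,q$ on $\Omega_{\{i\}}$, $\|p-q\|_d$ is the Vaserstein–Kantorovich–Rubinstein distance: $\|p-q\|_d=\sup\{|p(g)-q(g)|: g\in\mathcal{B}_d(\{i\}),\ |g(x)-g(y)|\le d(x,y)\ \forall x,y\in\Omega_{\{i\}}\}$, an $\mathcal{F}_{\{i\}}$-measurable function being regarded as a function on $\Omega_{\{i\}}$.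
   Formalization: For unbounded h one assumes that no k in Λ has both μ̃(b_k)=0 and δ_k(f_{[k+1,m_Λ]}h)=∞, since the product 0·∞ is then undefined and with 0·∞=0 the claim fails; all bounded h are covered, with 0·∞=0. *)

(* Defs.v *)
From HB Require Import structures.
From mathcomp Require Import all_boot all_order all_algebra.
From mathcomp Require Import all_classical all_reals all_analysis.
From mathcomp Require Import measurable_realfun.

Set Implicit Arguments.
Unset Strict Implicit.
Unset Printing Implicit Defensive.

Import Order.TTheory GRing.Theory Num.Theory.
Import numFieldNormedType.Exports.

Local Open Scope classical_set_scope.
Local Open Scope ring_scope.

(* Nonemptiness of Omega is only there because a [measurableType] must be
   pointed; on an empty Omega there is no probability measure at all. *)
Record confSpace (R : realType) (E : metricType R) := ConfSpace {
  adm :> set {ptws int -> E} ;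
  adm_neq0 : adm !=set0 }.

Section Configurations.
Context {R : realType} {E : metricType R}.
Implicit Types (Om : confSpace E) (S : set int) (i : int).

Definition conf Om : Type := set_type (adm Om).
HB.instance Definition _ Om := Topological.copy (conf Om) (set_type (adm Om)).

Lemma conf_inhabited Om : exists w : conf Om, True.
Proof. by have [w Omw] := adm_neq0 Om; exists (exist _ w (mem_set Omw)). Qed.

HB.instance Definition _ Om :=
  isPointed.Build (conf Om) (projT1 (cid (conf_inhabited Om))).

Definition spin Om (w : conf Om) i : E := (\val w : {ptws int -> E}) i.

(* [Fsp Om S] is Omega equipped with F_S; the one-site cylinders generate the
   same sigma-algebra as the cylinders with finite base in S. *)
Definition cylinders Om S : set (set (conf Om)) :=
  [set A | exists i, S i /\ exists2 B, <<s [set U : set E | open U] >> B &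
             A = [set w | B (spin w i)]].
Arguments cylinders Om S : clear implicits.

Definition Fsp Om S : Type := g_sigma_algebraType (cylinders Om S).
HB.instance Definition _ Om S := Measurable.copy (Fsp Om S)
  (g_sigma_algebraType (cylinders Om S)).

(* Omega_{i}, with the topology inherited from E and its Borel sigma-algebra *)
Definition siteSet Om i : set E := [set x | exists w : conf Om, spin w i = x].

Definition site Om i : Type := set_type (siteSet Om i).
HB.instance Definition _ Om i :=
  Topological.copy (site Om i) (set_type (siteSet Om i)).

Definition toSite Om i (w : conf Om) : site Om i :=
  exist _ (spin w i) (mem_set (ex_intro _ w erefl)).

HB.instance Definition _ Om i := isPointed.Build (site Om i) (toSite i point).

Definition Bsite Om i : Type := g_sigma_algebraType (@open (site Om i)).
HB.instance Definition _ Om i := Measurable.copy (Bsite Om i)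
  (g_sigma_algebraType (@open (site Om i))).

Definition proj_le Om i : Fsp Om `]-oo, i] -> Bsite Om i := @toSite Om i.

Lemma measurable_proj_le Om i :
  measurable_fun [set: Fsp Om `]-oo, i]] (@proj_le Om i).
Proof.
apply: (@measurability _ _ _ _ setT (@proj_le Om i) (@open (site Om i))) => //.
move=> _ [_ [U oU <-] <-]; rewrite setTI.
apply: sub_sigma_algebra; exists i; split; first by rewrite /= in_itv /=.
by exists U => //; exact: sub_sigma_algebra.
Qed.

HB.instance Definition _ Om i :=
  isMeasurableFun.Build _ _ _ _ (@proj_le Om i) (@measurable_proj_le Om i).

(* The oscillation of an F_S-measurable h at j.  Such an h is a function of
   w_S, so the supremum over pairs in Omega_S is taken over lifts of these pairs
   to Omega.  As x / 0 = 0 in R, the convention 0/0 = 0 is automatic. *)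
Definition osc Om S (j : int) (h : conf Om -> R) : \bar R :=
  ereal_sup [set r | exists xi eta : conf Om,
    (forall k, S k -> k != j -> spin xi k = spin eta k) /\
    r = (`|h xi - h eta| / mdist (spin xi j) (spin eta j))%:E].

(* For an h that is merely F-measurable the pairs range over Omega itself, the
   weakest reading of the condition. *)
Definition Bd Om (h : conf Om -> R) : Prop :=
  measurable_fun [set: Fsp Om setT] h /\
  (ereal_sup [set osc setT j h | j in [set: int]] < +oo)%E.

Definition BdOn Om S (h : conf Om -> R) : Prop :=
  measurable_fun [set: Fsp Om S] h /\ Bd h.

Definition vkr_dist Om i (p q : probability (Bsite Om i) R) : \bar R :=
  ereal_sup [set r | exists g : site Om i -> R,
    [/\ BdOn [set i] (g \o @toSite Om i),
        (forall x y : site Om i, `|g x - g y| <= mdist (\val x) (\val y)) &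
        r = (`| \int[p]_x g x - \int[q]_x g x |)%:E]].

(* [lis_ker f a b w] is f_[a,b]( . | w), relevant only for a <= b.  In the
   consistency condition it is enough to integrate nonnegative functions, for
   which the integrals always make sense. *)
Record lis Om := Lis {
  lis_ker :> forall a b : int, conf Om -> probability (Fsp Om `]-oo, b]) R ;
  lis_measurable : forall a b : int, a <= b ->
    forall A : set (Fsp Om `]-oo, b]), measurable A ->
    measurable_fun [set: Fsp Om `]-oo, a[] (lis_ker a b ^~ A) ;
  lis_proper : forall a b : int, a <= b ->
    forall B : set (Fsp Om `]-oo, a[), measurable B ->
    forall w, lis_ker a b w B = (\1_B w)%:E ;
  lis_consistent : forall a b c d : int, a <= b -> c <= a -> b <= d ->
    forall h : Fsp Om `]-oo, b] -> \bar R, measurable_fun setT h ->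
    (forall x, 0 <= h x)%E -> forall w,
    (\int[lis_ker c d w]_s \int[lis_ker a b s]_x h x =
     \int[lis_ker c d w]_s h s)%E }.

Definition continuous_lis Om (f : lis Om) : Prop :=
  forall a b : int, a <= b ->
  forall A : set (Fsp Om `[a, b]), measurable A ->
  continuous (fun w : conf Om => f a b w A).

Definition consistent Om (f : lis Om) (mu : probability (Fsp Om setT) R) :
    Prop :=
  forall a b : int, a <= b ->
  forall A : set (Fsp Om `]-oo, b]), measurable A ->
  (\int[mu]_w f a b w A = mu A)%E.

(* Measures are total functions on sets: equality is only meaningful on
   measurable sets. *)
Definition has_unique_consistent Om (f : lis Om) : Prop :=
  exists2 mu : probability (Fsp Om setT) R, consistent f mu &
    forall nu : probability (Fsp Om setT) R, consistent f nu ->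
    forall A : set (Fsp Om setT), measurable A -> nu A = mu A.

(* f_[a,b] h, with the convention f_[m+1,m] h = h *)
Definition lis_app Om (f : lis Om) (a b : int) (h : conf Om -> R) :
    conf Om -> R :=
  fun w => if a <= b then \int[f a b w]_x h x else h w.

(* the projection of f_{i}( . | w) over Omega_{i} *)
Definition site_law Om (f : lis Om) i (w : conf Om) :
    probability (Bsite Om i) R :=
  distribution (f i i w) (@proj_le Om i).

End Configurations.

(* Main.v *)
Require Import Defs.
From HB Require Import structures.
From mathcomp Require Import all_boot all_order all_algebra.
From mathcomp Require Import all_classical all_reals all_analysis.
From mathcomp Require Import measurable_realfun finmap.
From mathcomp Require Import ring lra zify.

Set Implicit Arguments.
Unset Strict Implicit.
Unset Printing Implicit Defensive.

Import Order.TTheory GRing.Theory Num.Theory.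
Import numFieldNormedType.Exports.

Local Open Scope classical_set_scope.
Local Open Scope ring_scope.

(** For a boundary condition w, let h_n(w) be the expectation of [h] under the
    kernel of [f] for the window [[-n, b]]. The mean of h_n under [mut]
    interpolates between the two means of [h].

    For the empty window it is the mean of [h] under [mut]. Enlarging the
    window on the left by the site k replaces g = f_[k+1, b] h by f_{k} g, and
    [mut] has the same mean for g as for the one-site kernel of [ft] applied to
    g, as [mut] is consistent with [ft]; so the mean changes by the [mut]-mean
    of a difference of one-site kernels of [f] and [ft], applied to g. Both
    kernels freeze the spins to the left of k; there g is a Lipschitz function
    of the spin at k, with its oscillation as constant, and McShane's extension
    makes a test function for the Vaserstein distance of it
    ([fibre_lipschitz]). The change is therefore at most the k-th term of the
    sum ([one_site_comparison]), and the terms add up ([telescoping]). If the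
    oscillation is infinite and b_k has mean zero, the two one-site kernels
    agree almost surely ([site_law_eq]).

    At the other end, the mean of h_n under [mut] tends to the mean of [h]
    under [mu] ([lis_app_mean_cvg]). By dominated convergence it is enough that
    h_n(w) tends to it for each w. The probabilities of every local event under
    the kernels of the windows [[-n, n]] with boundary condition w have limits
    along an ultrafilter. By continuity of the kernels and Dini's theorem
    ([lis_dini]), these limits are continuous at the empty set on the events of
    each fixed window; by inner regularity and compactness of the configuration
    space they are so on all local events, hence extend to a probability
    ([local_event_extension]). That probability is consistent with [f]
    ([limit_state]), so it is [mu], whatever the ultrafilter.

    Both ends need [h] to be bounded. If the sum is finite and no term of the
    window hides an infinite oscillation, [h] stays within a fixed distance of
    its expectation over the window ([osc_dist_lis_app]), and Dini's theorem
    bounds the latter ([bounded_of_dist_lis_app]). *)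


(** * Integrals of bounded functions against probabilities *)

Section probability_integrals.
Context d (T : measurableType d) (R : realType).
Implicit Types (p : probability T R) (h k : T -> R) (c C M e : R).

Lemma bounded_integrable p h M : measurable_fun setT h ->
  (forall x, `|h x| <= M) -> p.-integrable setT (EFin \o h).
Proof.
move=> mh hM; apply: measurable_bounded_integrable => //.
  by rewrite -ge0_fin_numE// fin_num_measure.
exists M; split; first exact: num_real.
by move=> x Mx y _ /=; exact: le_trans (hM y) (ltW Mx).
Qed.

Lemma Rintegral_prob_cst p c : \int[p]_x c = c :> R.
Proof. by rewrite Rintegral_cst// (_ : fine _ = 1) ?mulr1// -[RHS]/(fine 1%E)
  -(probability_setT p). Qed.

(** Control on an event of full measure is what is available for a conditional
    law, which only sees one fibre; cutting [h] off outside that event makes it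
    bounded without changing its integral. *)
Lemma Rintegral_near_cst p h c C (S : set T) : measurable S -> p S = 1%E ->
  measurable_fun setT h -> (forall x, S x -> `|h x - c| <= C) ->
  p.-integrable setT (EFin \o h) /\ `|\int[p]_x h x - c| <= C.
Proof.
move=> mS pS mh hS.
have S0 : S !=set0.
  apply/set0P/eqP => S0; move: pS; rewrite S0 measure0 => /eqP.
  by rewrite eq_sym onee_eq0.
have C0 : 0 <= C by case: S0 => x /hS; exact: le_trans.
pose k := fun x => (h x - c) * \1_S x.
have mk : measurable_fun setT k.
  by apply: measurable_funM; [exact: measurable_funB|exact: measurable_indic].
have kC x : `|k x| <= C.
  rewrite /k indicE; case: (boolP (x \in S)) => [/set_mem /hS|_].
    by rewrite mulr1.
  by rewrite mulr0 normr0.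
have ik := bounded_integrable p mk kC.
have ic : p.-integrable setT (EFin \o cst c).
  by apply: (@bounded_integrable _ _ `|c|).
have ikc : p.-integrable setT (EFin \o (fun x => k x + c)).
  exact: (integrableD measurableT ik ic).
have ae : ae_eq p setT (EFin \o (fun x => k x + c)) (EFin \o h).
  exists (~` S); split; [exact: measurableC| |].
    have : p (~` S) = 0%E by rewrite probability_setC// pS subee.
    exact.
  move=> x /=; apply: contra_not => Sx _.
  by rewrite /k indicE mem_set// mulr1 subrK.
have mh' : measurable_fun setT (EFin \o h) by exact/measurable_EFinP.
have mkc : measurable_fun setT (EFin \o (fun x => k x + c)).
  by apply/measurable_EFinP; exact: measurable_funD.
have -> : \int[p]_x h x = \int[p]_x (k x + c).
  congr fine; exact: (ae_eq_integral _ _ measurableT mh' mkc (ae_eq_sym ae)).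
split.
  have /integrableP[_ iknorm] := ikc; apply/integrableP; split => //.
  rewrite (_ : (\int[p]_x _)%E =
      (\int[p]_x `|(EFin \o (fun x : T => (k x + c)%R)) x|)%E)//.
  apply: ae_eq_integral => //; last exact: ae_eq_abse (ae_eq_sym ae).
  - exact: measurableT_comp.
  - exact: measurableT_comp.
rewrite RintegralD// Rintegral_prob_cst addrK.
apply: le_trans (le_normr_Rintegral _ _) _ => //.
rewrite -[leRHS](Rintegral_prob_cst p); apply: le_Rintegral => //.
- exact: integrable_norm.
- by apply: (@bounded_integrable _ _ `|C|).
Qed.

Lemma Rintegral_as_cst p h c (S : set T) : measurable S -> p S = 1%E ->
  measurable_fun setT h -> (forall x, S x -> h x = c) -> \int[p]_x h x = c.
Proof.
move=> mS pS mh hS.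
have [|_] := @Rintegral_near_cst p h c 0 S mS pS mh.
  by move=> x /hS ->; rewrite subrr normr0.
by rewrite normr_le0 subr_eq0 => /eqP.
Qed.

Lemma Rintegral_norm_le p h M : measurable_fun setT h ->
  (forall x, `|h x| <= M) -> `|\int[p]_x h x| <= M.
Proof.
move=> mh hM.
have [|_] := @Rintegral_near_cst p h 0 M setT measurableT (probability_setT p)
  mh.
  by move=> x _; rewrite subr0.
by rewrite subr0.
Qed.

Lemma Rintegral_dist_le p h k M e : measurable_fun setT h ->
  measurable_fun setT k -> (forall x, `|h x| <= M) ->
  (forall x, `|h x - k x| <= e) -> `|\int[p]_x h x - \int[p]_x k x| <= e.
Proof.
move=> mh mk hM hk.
have kM x : `|k x| <= M + e.
  rewrite -(subrK (h x) (k x)) (le_trans (ler_normD _ _))// addrC lerD//.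
  by rewrite distrC.
rewrite -RintegralB//;
  [|exact: bounded_integrable hM|exact: bounded_integrable kM].
apply: Rintegral_norm_le => //; exact: measurable_funB.
Qed.

Lemma EFin_Rintegral p h M : measurable_fun setT h ->
  (forall x, `|h x| <= M) -> (\int[p]_x (h x)%:E)%E = (\int[p]_x h x)%:E.
Proof.
move=> mh hM; rewrite fineK//.
exact: integrable_fin_num (bounded_integrable p mh hM).
Qed.

End probability_integrals.

(** * Events and functions of a set of sites *)

Definition cyl (R : realType) (E : metricType R) (Om : confSpace E) (i : int)
  (B : set E) : set (conf Om) := [set w | B (spin w i)].

Definition fibre (R : realType) (E : metricType R) (Om : confSpace E) (k : int)
  (w : conf Om) : set (conf Om) :=
    [set x | forall i, i < k -> spin x i = spin w i].

Arguments cyl {R E} Om i B.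
Arguments fibre {R E Om} k w.

Notation mF Om S := (@measurable _ (Fsp Om S)).
Notation mfun Om S h := (measurable_fun [set: Fsp Om S] h).

Section sigma_algebras.
Context (R : realType) (E : metricType R) (Om : confSpace E).
Implicit Types (S : set int) (A : set (conf Om)) (w x y : conf Om).

Lemma mF_sub S S' A : S `<=` S' -> mF Om S A -> mF Om S' A.
Proof.
move=> SS'; apply: sub_sigma_algebra2 => B [i [Si BA]].
by exists i; split; [exact: SS'|].
Qed.

Lemma mfun_sub S S' d (T : sigmaRingType d) (h : conf Om -> T) : S `<=` S' ->
  mfun Om S h -> mfun Om S' h.
Proof. by move=> SS' mh _ B mB; apply: mF_sub SS' _; exact: mh. Qed.

Lemma mF_cyl S i (B : set E) : S i -> <<s open >> B -> mF Om S (cyl Om i B).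
Proof. by move=> Si mB; apply: sub_sigma_algebra; exists i; split => //;
  exists B. Qed.

Lemma borel_closed (C : set E) : closed C -> <<s open >> C.
Proof.
move=> cC; rewrite -(setCK C) -setTD; apply: sigma_algebraCD.
by apply: sub_gen_smallest; exact: closed_openC.
Qed.

(** The events that cannot separate two given configurations form a
    sigma-algebra, which contains the cylinders with base in [S]. *)
Lemma mF_agree S A x y : mF Om S A -> (forall i, S i -> spin x i = spin y i) ->
  A x -> A y.
Proof.
move=> mA xy.
suff : A x <-> A y by case.
have : sigma_algebra setT [set A : set (conf Om) | A x <-> A y].
  split => //=.
  - by move=> B Bxy; split => -[_ nB]; split => // By; apply: nB; exact/Bxy.
  - by move=> F Fxy; split => -[n _ Fn]; exists n => //; exact/Fxy.
move=> sA; apply: (smallest_sub sA _ mA) => _ [i [Si [B _ ->]]] /=.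
by rewrite xy.
Qed.

Lemma mfun_agree S (h : conf Om -> R) x y : mfun Om S h ->
  (forall i, S i -> spin x i = spin y i) -> h x = h y.
Proof.
move=> mh xy; have := mh measurableT [set h x] (measurable_set1 _).
by rewrite setTI => /mF_agree /(_ xy) /(_ erefl) /esym.
Qed.

Lemma mfun_agree_ereal S (h : conf Om -> \bar R) x y : mfun Om S h ->
  (forall i, S i -> spin x i = spin y i) -> h x = h y.
Proof.
move=> mh xy; have := mh measurableT [set h x] (emeasurable_set1 _).
by rewrite setTI => /mF_agree /(_ xy) /(_ erefl) /esym.
Qed.

(** Points of a metric space are closed, and there are countably many sites. *)
Lemma mF_fibre k w : mF Om `]-oo, k[ (fibre k w).
Proof.
rewrite (_ : fibre k w =
    \bigcap_n cyl Om (k - 1 - n%:Z) [set spin w (k - 1 - n%:Z)]).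
  apply: (@bigcapT_measurable _ (Fsp Om `]-oo, k[)) => n; apply: mF_cyl.
    by rewrite /= in_itv/=; lia.
  apply: borel_closed; apply: accessible_closed_set1.
  exact/hausdorff_accessible/metric_hausdorff.
apply/seteqP; split => x /= xw.
  by move=> n _; apply: xw; lia.
move=> i ik; have := xw `|(k - 1 - i)%R|%N I.
by rewrite /cyl/= (_ : k - 1 - _ = i)//; lia.
Qed.

Lemma mfun_spin S i (g : E -> R) : S i -> continuous g ->
  mfun Om S (fun w => g (spin w i)).
Proof.
move=> Si cg; apply:
  (@measurability _ _ (Fsp Om S) _ setT _ _ (RGenOInfty.measurableE R)).
move=> _ [_ [a ->] <-]; rewrite setTI.
suff oU : open (g @^-1` `]a, +oo[%classic).
  exact: mF_cyl Si (sub_gen_smallest oU).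
by apply: open_comp => [? _|]; [exact: cg|exact: interval_open].
Qed.

(** Events A1 of D1 and A2 of D2 are to be thought of as bearing on disjoint
    sets of sites that together exhaust S: their intersections form a
    pi-system, and that pi-system contains enough cylinders. *)
Lemma measure_eq_rectangles S (D1 D2 : set (set (conf Om)))
    (p q : {measure set (Fsp Om S) -> \bar R}) :
  D1 `<=` mF Om S -> D2 `<=` mF Om S -> setI_closed D1 -> setI_closed D2 ->
  D1 setT -> D2 setT ->
  (forall i C, S i -> closed C -> D1 (cyl Om i C) \/ D2 (cyl Om i C)) ->
  (p setT < +oo)%E ->
  (forall A1 A2, D1 A1 -> D2 A2 -> p (A1 `&` A2) = q (A1 `&` A2)) ->
  forall A, mF Om S A -> p A = q A.
Proof.
move=> D1S D2S I1 I2 T1 T2 D12 pfin pq A mA.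
pose G := [set A | exists A1 A2, [/\ D1 A1, D2 A2 & A = A1 `&` A2]].
have GT : G setT by exists setT, setT; rewrite setTI.
apply: (@measure_unique _ _ (Fsp Om S) G (fun=> setT)) => //.
- apply/seteqP; split.
    apply: smallest_sub; first exact: smallest_sigma_algebra.
    move=> _ [i [Si [B mB ->]]].
    have : sigma_algebra setT [set B | <<s G >> (cyl Om i B)].
      split => /=.
      - by rewrite (_ : cyl Om i set0 = set0)//; exact: sigma_algebra0.
      - move=> B'; rewrite !setTD => /sigma_algebraCD.
        by rewrite setTD.
      - by move=> F GF; exact: sigma_algebra_bigcup GF.
    move=> sG; apply: (smallest_sub sG _ mB) => U oU /=.
    rewrite -(setCK U); have := D12 i (~` U) Si (open_closedC oU).
    have GC B' : G (cyl Om i B') -> <<s G >> (cyl Om i (~` B')).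
      move=> GB'; rewrite (_ : cyl _ _ _ = setT `\` cyl Om i B').
        by apply: sigma_algebraCD; exact: sub_gen_smallest.
      by rewrite setTD.
    case=> H; apply: GC.
      by exists (cyl Om i (~` U)), setT; rewrite setIT.
    by exists setT, (cyl Om i (~` U)); rewrite setTI.
  apply: smallest_sub; first exact: sigma_algebra_measurable.
  move=> _ [A1 [A2 [h1 h2 ->]]].
  by apply: (@measurableI _ (Fsp Om S)); [exact: D1S|exact: D2S].
- move=> _ _ [A1 [A2 [h1 h2 ->]]] [B1 [B2 [h3 h4 ->]]].
  exists (A1 `&` B1), (A2 `&` B2); split; [exact: I1|exact: I2|].
  by rewrite setIACA.
- by rewrite bigcup_const.
- by move=> _ [A1 [A2 [h1 h2 ->]]]; exact: pq.
Qed.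

End sigma_algebras.

(** * Uniform approximation by simple functions *)

Definition simple_fun (T : Type) (R : realType) N (A : nat -> set T)
  (c : nat -> R)
  : T -> R := fun x => \sum_(i < N) c i * \1_(A i) x.

(** The approximation is uniform, not merely monotone, so that it can be used
    with families of functionals before any of their limits is known to be an
    integral. *)
Definition unif_approx (T : Type) (R : realType) (D : set (set T)) (G : T -> R)
  :=
  forall e : R, 0 < e -> exists N A c,
    (forall i, D (A i)) /\ forall x, `|G x - simple_fun N A c x| <= e.

Section simple.
Context d (T : measurableType d) (R : realType).
Implicit Types (h : T -> R) (p : probability T R).

(** The sum is [e] times the integer part of [t / e], obtained by counting the
    levels below [t]. *)
Lemma layer_cake N (t e : R) : 0 < e -> 0 <= t -> t < N%:R * e ->
  `|t - \sum_(i < N) e * (i.+1%:R * e <= t)%R%:R| <= e.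
Proof.
move=> e0; elim: N t => [|N IH] t t0; first by rewrite mul0r ltNge t0.
move=> tN; rewrite big_ord_recr/= [(_ <= t)%R in X in _ + X]leNgt tN mulr0
  addr0.
have [tlt|Nt] := ltP t (N%:R * e); first exact: IH.
rewrite (eq_bigr (fun=> e)) => [|i _]; last first.
  rewrite (_ : _ <= t) ?mulr1//; apply: le_trans Nt.
  by rewrite ler_pM2r// ler_nat.
rewrite sumr_const card_ord -mulr_natl ger0_norm ?subr_ge0//.
by move: tN; rewrite -natr1 mulrDl mul1r; lra.
Qed.

Lemma measurable_unif_approx h M : measurable_fun setT h ->
  (forall x, `|h x| <= M) -> unif_approx measurable h.
Proof.
move=> mh hM e e0.
have [N NM] : exists N : nat, M + M < N%:R * e.
  exists (Num.bound ((M + M) / e)); rewrite -ltr_pdivrMr//.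
  have M0 : 0 <= M by exact: le_trans (hM point).
  by apply: archi_boundP; rewrite divr_ge0 ?addr_ge0// ltW.
(* The whole space, with coefficient - M, undoes the shift that makes [h]
   nonnegative. *)
pose A i := if i is j.+1 then [set x | j.+1%:R * e <= h x + M] else setT.
exists N.+1, A, (fun i => if i is j.+1 then e else - M); split.
  case=> [|j] //=; rewrite -[X in measurable X]setTI.
  by apply: measurable_fun_le => //; exact: measurable_funD.
move=> x; rewrite /simple_fun big_ord_recl/= indicT mulr1 opprD opprK addrA.
rewrite (eq_bigr (fun i : 'I_N => e * (i.+1%:R * e <= h x + M)%R%:R));
  last first.
  move=> i _; rewrite indicE; congr (_ * (nat_of_bool _)%:R).
  by apply/idP/idP => [/set_mem|hx] //; exact/mem_set.
have /ler_normlP[h1 h2] := hM x.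
by apply: layer_cake => //; lra.
Qed.

Lemma measurable_simple N (A : nat -> set T) (c : nat -> R) :
  (forall i, measurable (A i)) ->
  measurable_fun setT (simple_fun N A c).
Proof.
move=> mA; apply: measurable_sum => i.
by apply: measurable_funM => //; exact: measurable_indic.
Qed.

Lemma simple_bounded N (A : nat -> set T) (c : nat -> R) :
  exists M, forall x : T, `|simple_fun N A c x| <= M.
Proof.
exists (\sum_(i < N) `|c i|) => x; apply: le_trans (ler_norm_sum _ _ _) _.
apply: ler_sum => i _; rewrite normrM ler_piMr// indicE.
by case: (_ \in _); rewrite ?normr0 ?normr1 ?ler01.
Qed.

Lemma Rintegral_simple p N (A : nat -> set T) (c : nat -> R) :
  (forall i, measurable (A i)) ->
  \int[p]_x simple_fun N A c x = \sum_(i < N) c i * fine (p (A i)).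
Proof.
move=> mA; elim: N => [|N IH].
  rewrite big_ord0; rewrite /simple_fun.
  under eq_Rintegral do rewrite big_ord0.
  exact: Rintegral_prob_cst.
rewrite big_ord_recr /= -IH; rewrite /simple_fun.
under eq_Rintegral do rewrite big_ord_recr/=.
have i1 : p.-integrable setT (EFin \o (\1_(A N) : T -> R)).
  apply: (@bounded_integrable _ _ _ _ _ 1) => // x.
  by rewrite indicE; case: (_ \in _); rewrite ?normr0 ?normr1 ?ler01.
rewrite RintegralD//.
- by rewrite RintegralZl// /Rintegral integral_indic// setIT.
- have [M sM] := simple_bounded N A c.
  exact: bounded_integrable (measurable_simple N c mA) sM.
- exact: (integrableZl measurableT (c N) i1).
Qed.

End simple.

(** * Kernels acting on bounded functions *)

Lemma probability_setI1 d (T : measurableType d) (R : realType)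
  (p : probability T R) (A B : set T) : measurable A -> measurable B ->
  p A = 1%E -> p (A `&` B) = p B.
Proof.
move=> mA mB pA; rewrite [RHS](measureDI p mB mA) setIC.
rewrite -[LHS]add0e; congr (_ + _)%E; apply/esym.
apply: (@subset_measure0 _ _ _ _ _ (~` A)) => //.
- exact: measurableD.
- exact: measurableC.
- by rewrite [LHS](probability_setC p mA) pA subee.
Qed.

Section specification.
Context (R : realType) (E : metricType R) (Om : confSpace E) (f : lis Om).
Implicit Types (a b c d : int) (A : set (conf Om)) (w x y : conf Om)
  (h : conf Om -> R) (r M : R).

Lemma past_sub b d : b <= d -> `]-oo, b]%classic `<=` `]-oo, d]%classic.
Proof. by move=> bd i /=; rewrite !in_itv/= => /le_trans; exact. Qed.

Lemma strict_past_sub a b : a <= b + 1 -> `]-oo, a[%classic `<=` `]-oo,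
  b]%classic.
Proof. by move=> ab i /=; rewrite !in_itv/=; lia. Qed.

Lemma lis_agree a b x y A : a <= b ->
  (forall i, i < a -> spin x i = spin y i) ->
  mF Om `]-oo, b] A -> f a b x A = f a b y A.
Proof.
move=> ab xy mA; apply: (mfun_agree_ereal (lis_measurable f ab mA)) => i.
by rewrite /= in_itv/=; exact: xy.
Qed.

Lemma lis_app_agree a b x y h : a <= b ->
  (forall i, i < a -> spin x i = spin y i) ->
  lis_app f a b h x = lis_app f a b h y.
Proof.
move=> ab xy; rewrite /lis_app ab; congr fine.
by apply: eq_measure_integral => A mA _; exact: lis_agree.
Qed.

Lemma lis_fibre a b w : a <= b -> f a b w (fibre a w) = 1%E.
Proof.
move=> ab; rewrite (lis_proper f ab (mF_fibre w)).
by rewrite indicE mem_set.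
Qed.

Lemma mF_fibre_le a b w : a <= b + 1 -> mF Om `]-oo, b] (fibre a w).
Proof. by move=> ab; apply: mF_sub (mF_fibre w); exact: strict_past_sub. Qed.

(** A kernel charges only the fibre of its boundary condition, on which a
    function of the strict past is constant. *)
Lemma lis_app_past a b w h : a <= b -> mfun Om `]-oo, a[ h ->
  lis_app f a b h w = h w.
Proof.
move=> ab mh; rewrite /lis_app ab.
apply: (Rintegral_as_cst (mF_fibre_le w _) (lis_fibre w ab)).
- lia.
- by apply: mfun_sub mh; apply: strict_past_sub; lia.
- by move=> x xw; apply: (mfun_agree mh) => i; rewrite /= in_itv/=; exact: xw.
Qed.

Lemma lis_app_bounded a b w h M : mfun Om `]-oo, b] h ->
  (forall x, `|h x| <= M) -> `|lis_app f a b h w| <= M.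
Proof.
move=> mh hM; rewrite /lis_app; case: ifPn => // ab.
exact: Rintegral_norm_le.
Qed.

(** Adding a constant makes a bounded function nonnegative: this carries
    statements about nonnegative integrals over to bounded functions. *)
Lemma lis_app_shift a b w h M r : a <= b -> mfun Om `]-oo, b] h ->
  (forall x, `|h x| <= M) ->
  (\int[f a b w]_x (h x + r)%:E = (lis_app f a b h w + r)%:E)%E.
Proof.
move=> ab mh hM; rewrite /lis_app ab.
have hMr x : `|h x + r| <= M + `|r|.
  by rewrite (le_trans (ler_normD _ _))// lerD2r.
rewrite (@EFin_Rintegral _ _ _ (f a b w) _ _ _ hMr); last exact:
  measurable_funD.
rewrite RintegralD// ?Rintegral_prob_cst//.
  exact: (bounded_integrable _ mh hM).
by apply: (@bounded_integrable _ _ _ _ _ `|r|); [exact: measurable_cst|].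
Qed.

Lemma mfun_lis_app a b h M : a <= b -> mfun Om `]-oo, b] h ->
  (forall x, `|h x| <= M) -> mfun Om `]-oo, a[ (lis_app f a b h).
Proof.
move=> ab mh hM.
have h0 x : (0 <= (h x + M)%:E)%E.
  by have /ler_normlP[] := hM x; rewrite lee_fin; lra.
have mhM : mfun Om `]-oo, b] (fun x => (h x + M)%:E).
  by apply/measurable_EFinP; exact: measurable_funD.
have := @measurable_fun_integral_kernel _ _ (Fsp Om `]-oo, a[)
  (Fsp Om `]-oo, b]) R (f a b) (lis_measurable f ab) _ h0 mhM.
rewrite (_ : (fun _ => _) = EFin \o (fun w => lis_app f a b h w + M)).
  move/measurable_EFinP => mI.
  rewrite (_ : lis_app f a b h = fun w => lis_app f a b h w + M - M).
    exact: measurable_funB.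
  by apply/funext => w; rewrite addrK.
by apply/funext => w /=; rewrite (lis_app_shift w M ab mh hM).
Qed.

Lemma lis_app_consistent a b c d w h M : c <= a -> a <= b -> b <= d ->
  mfun Om `]-oo, b] h -> (forall x, `|h x| <= M) ->
  lis_app f c d (lis_app f a b h) w = lis_app f c d h w.
Proof.
move=> ca ab bd mh hM.
have cd : c <= d by exact: le_trans ca (le_trans ab bd).
have h0 x : (0 <= (h x + M)%:E)%E.
  by have /ler_normlP[] := hM x; rewrite lee_fin; lra.
have mhM : mfun Om `]-oo, b] (fun x => (h x + M)%:E).
  by apply/measurable_EFinP; exact: measurable_funD.
have := lis_consistent f ab ca bd mhM h0 w.
have mg := mfun_lis_app ab mh hM.
rewrite (_ : (\int[f c d w]_s \int[f a b s]_x _ =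
  \int[f c d w]_s (lis_app f a b h s + M)%:E)%E).
  rewrite (@lis_app_shift _ _ _ _ M)//; first last.
  - by move=> x; exact: lis_app_bounded.
  - by apply: mfun_sub mg; apply: strict_past_sub; lia.
  rewrite (@lis_app_shift _ _ _ _ M)//; first by move=> [/addIr].
  by apply: mfun_sub mh; exact: past_sub.
by apply: eq_integral => s _; rewrite (lis_app_shift s M ab mh hM).
Qed.

(** Raising the right end of the window does not change expectations of
    functions of the past of the smaller window: the kernel for the smaller
    window is itself a function of the boundary condition. *)
Lemma lis_app_restrict b c d w h M : c <= b -> b <= d ->
  mfun Om `]-oo, b] h -> (forall x, `|h x| <= M) ->
  lis_app f c d h w = lis_app f c b h w.
Proof.
move=> cb bd mh hM; rewrite -(lis_app_consistent w (lexx c) cb bd mh hM).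
rewrite lis_app_past//; first exact: le_trans bd.
exact: mfun_lis_app hM.
Qed.

(** Integrating over a window can be done in two steps, the rightmost part of
    the window first. *)
Lemma lis_app_comp a b c w h M : c < a -> a <= b ->
  mfun Om `]-oo, b] h -> (forall x, `|h x| <= M) ->
  lis_app f c b h w = lis_app f c (a - 1) (lis_app f a b h) w.
Proof.
move=> ca ab mh hM; rewrite -(lis_app_consistent w (ltW ca) ab (lexx b) mh hM).
apply: (@lis_app_restrict _ _ _ _ _ M); [lia|lia| |].
  by apply: mfun_sub (mfun_lis_app ab mh hM); apply: strict_past_sub; lia.
by move=> x; exact: lis_app_bounded.
Qed.

Lemma lis_app_indic a b w A : a <= b -> mF Om `]-oo, b] A ->
  lis_app f a b \1_A w = fine (f a b w A).
Proof. by move=> ab mA;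
  rewrite /lis_app ab /Rintegral integral_indic// setIT. Qed.

Lemma lis_app_simple a b w N (A : nat -> set (conf Om)) (c : nat -> R) :
  a <= b -> (forall i, mF Om `]-oo, b] (A i)) ->
  lis_app f a b (simple_fun N A c) w = \sum_(i < N) c i * fine (f a b w (A i)).
Proof. by move=> ab mA; rewrite /lis_app ab; exact:
  (Rintegral_simple _ N c mA). Qed.

(** Events of the strict past have probability 0 or 1 given the boundary
    condition, hence factor out. *)
Lemma lis_proper_rect a b w A1 A2 : a <= b ->
  mF Om `]-oo, a[ A1 -> mF Om `]-oo, b] A2 ->
  f a b w (A1 `&` A2) = ((\1_A1 w)%:E * f a b w A2)%E.
Proof.
move=> ab mA1 mA2.
have mA1' : mF Om `]-oo, b] A1 by apply: mF_sub mA1; apply: strict_past_sub;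
  lia.
have fA1 := lis_proper f ab mA1 w; rewrite indicE.
have [wA1|wA1] := boolP (w \in A1); rewrite ?mul1e ?mul0e.
  by rewrite [LHS]probability_setI1// fA1 indicE wA1.
apply: (@subset_measure0 _ _ _ (f a b w) _ A1).
- exact: (@measurableI _ (Fsp Om `]-oo, b])).
- by [].
- exact: subIsetl.
- by move: fA1; rewrite indicE (negbTE wA1).
Qed.

End specification.

Section consistent.
Context (R : realType) (E : metricType R) (Om : confSpace E) (f : lis Om).
Variables (mu : probability (Fsp Om setT) R) (mu_f : consistent f mu).

(** Invariance is known for events; both sides are linear and continuous for
    the uniform norm, so it passes to uniform limits of simple functions. *)
Lemma consistent_app (a b : int) (h : conf Om -> R) (M : R) : a <= b ->
  mfun Om `]-oo, b] h ->
  (forall x, `|h x| <= M) ->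
  \int[mu]_w lis_app f a b h w = \int[mu]_w h w.
Proof.
move=> ab mh hM.
have mg := mfun_lis_app f ab mh hM.
have gM x := lis_app_bounded f a x mh hM.
suff H (e : R) : 0 < e ->
    `|\int[mu]_w lis_app f a b h w - \int[mu]_w h w| <= e.
  by apply/eqP; rewrite -subr_eq0 -normr_le0; apply/ler_addgt0Pr => e e0;
    rewrite add0r; exact: H.
move=> e0.
have [N [A [c [mA hA]]]] :=
  measurable_unif_approx mh hM (divr_gt0 e0 (ltr0n R 2)).
have subT S : S `<=` [set: int] by [].
have ms := measurable_simple N c mA.
have [K sK] := simple_bounded N A c.
have sE : \int[mu]_w lis_app f a b (simple_fun N A c) w =
    \int[mu]_w simple_fun N A c w.
  have mAT i : mF Om setT (A i) by apply: mF_sub (mA i).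
  rewrite (Rintegral_simple mu N c mAT).
  under eq_Rintegral do rewrite lis_app_simple//.
  have mfA i : mfun Om setT (fun w => fine (f a b w (A i))).
    apply: measurableT_comp => //.
    by apply: mfun_sub (lis_measurable f ab (mA i)).
  have fA1 i w : `|fine (f a b w (A i))| <= 1.
    rewrite ger0_norm ?fine_ge0// -lee_fin fineK ?fin_num_measure//.
    exact: probability_le1.
  have ifA i : mu.-integrable setT (EFin \o (fun w => fine (f a b w (A i)))).
    exact: (bounded_integrable _ (mfA i) (fA1 i)).
  have icA i : mu.-integrable setT
      (EFin \o (fun w => c i * fine (f a b w (A i)))).
    exact: (integrableZl measurableT (c i) (ifA i)).
  elim: (N) => [|n IH].
    rewrite big_ord0; under eq_Rintegral do rewrite big_ord0.
    exact: Rintegral_prob_cst.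
  under eq_Rintegral do rewrite big_ord_recr/=.
  rewrite RintegralD//.
    rewrite IH big_ord_recr/=; congr (_ + _).
    rewrite RintegralZl//; congr (_ * fine _).
    rewrite -(mu_f ab (mA n)); apply: eq_integral => w _ /=.
    by rewrite fineK// fin_num_measure.
  rewrite (_ : _ \o _ = (fun w => \sum_(i < n)
      (EFin \o (fun w => c i * fine (f a b w (A i)))%R) w)%E).
    exact: integrable_sum.
  by apply/funext => w /=; rewrite sumEFin.
have h1 : `|\int[mu]_w lis_app f a b h w -
    \int[mu]_w lis_app f a b (simple_fun N A c) w| <= e / 2.
  apply: (@Rintegral_dist_le _ _ _ mu _ _ M _ (mfun_sub (subT _) mg)
    (mfun_sub (subT _) (mfun_lis_app f ab ms sK)) gM).
  move=> x; rewrite /lis_app ab; exact: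
    (@Rintegral_dist_le _ _ _ (f a b x) _ _ M _ mh ms hM).
have h2 : `|\int[mu]_w h w - \int[mu]_w simple_fun N A c w| <= e / 2.
  exact: (@Rintegral_dist_le _ _ _ mu _ _ M _ (mfun_sub (subT _) mh)
    (mfun_sub (subT _) ms) hM).
rewrite sE in h1.
rewrite [e]splitr; apply: le_trans (lerD h1 h2).
rewrite [X in _ <= _ + X]distrC; apply: le_trans (ler_normD _ _).
by rewrite addrA subrK.
Qed.

End consistent.

(** * Compactness and local events *)

Section configuration_space.
Context (R : realType) (E : metricType R) (Om : confSpace E).
Implicit Types (A B V W : set (conf Om)) (x w : conf Om).

(** A cluster point in the product space lies in the compact set of admissible
    configurations, and nearness in the two topologies is the same. *)
Lemma compact_conf : compact (adm Om) -> compact [set: conf Om].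
Proof.
move=> cOm F FF _.
have FOm : (\val @ F) (adm Om).
  rewrite /nbhs/=; apply: filterS filterT => x _; exact/set_mem/(valP x).
have [p [Omp clp]] := cOm _ _ FOm.
exists (exist _ p (mem_set Omp) : conf Om); split=> // A B FA.
rewrite nbhsE => -[_ [ [Q oO <-] /= Op] OB].
have [|_ [ [y Ay <-] Oy]] := clp (\val @` A) Q _ (open_nbhs_nbhs (conj oO Op)).
  by rewrite /nbhs/=; apply: filterS FA => y Ay; exists y.
by exists y; split => //; exact: OB.
Qed.

Lemma spin_continuous i : continuous (fun w : conf Om => spin w i).
Proof.
move=> w; apply: (@continuous_comp (conf Om) {ptws int -> E} _ \val (@^~ i)).
  exact: initial_continuous.
exact: (@proj_continuous int (fun=> E) i).
Qed.

Lemma open_cyl i (B : set E) : open B -> open (cyl Om i B).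
Proof. by move=> oB; apply: open_comp => // w _; exact: spin_continuous. Qed.

Lemma closed_cyl i (B : set E) : closed B -> closed (cyl Om i B).
Proof. by move=> oB; apply: closed_comp => // w _; exact: spin_continuous. Qed.

Definition window (m : nat) : set int := `[- m%:Z, m%:Z]%classic.

Definition local_event : set (set (conf Om)) :=
  [set A : set (conf Om) | exists m, mF Om (window m) A].

Lemma window_sub m n : (m <= n)%N -> window m `<=` window n.
Proof. by move=> mn i; rewrite /window/= !in_itv/=; lia. Qed.

Lemma local_eventI : setI_closed local_event.
Proof.
move=> A B [m mA] [n mB]; exists (maxn m n).
apply: (@measurableI _ (Fsp Om (window (maxn m n)))).
  by apply: mF_sub mA; apply: window_sub; rewrite leq_maxl.
by apply: mF_sub mB; apply: window_sub; rewrite leq_maxr.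
Qed.

Lemma local_eventC : setC_closed local_event.
Proof. by move=> A [m mA]; exists m; exact:
  (@measurableC _ (Fsp Om (window m))). Qed.

Lemma local_eventT : local_event setT.
Proof. by exists 0%N; exact: (@measurableT _ (Fsp Om (window 0))). Qed.

Lemma local_event0 : local_event set0.
Proof. by exists 0%N; exact: (@measurable0 _ (Fsp Om (window 0))). Qed.

Lemma local_eventU : setU_closed local_event.
Proof.
move=> A B lA lB; rewrite -(setCK (A `|` B)) setCU.
by apply: local_eventC; apply: local_eventI; exact: local_eventC.
Qed.

Lemma local_eventD : setD_closed local_event.
Proof. by move=> A B lA lB; apply: local_eventI => //; exact: local_eventC. Qed.

Lemma local_cyl i (B : set E) : <<s open >> B -> local_event (cyl Om i B).
Proof.
move=> mB; exists `|i|%N; apply: mF_cyl => //.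
by rewrite /window/= in_itv/=; lia.
Qed.

(** The open local events around [x] generate a filter that converges to [x] in
    each coordinate, therefore in the product topology. *)
Lemma nbhs_local_event x W : nbhs x W ->
  exists V, [/\ local_event V, open V, V x & V `<=` W].
Proof.
pose G : set_system (conf Om) :=
  filter_from [set V | [/\ local_event V, open V & V x]] id.
have FG : Filter G.
  apply: filter_from_filter.
    by exists setT; split; [exact: local_eventT|exact: openT|].
  move=> V V' [lV oV Vx] [lV' oV' Vx']; exists (V `&` V') => //.
  by split; [exact: local_eventI|exact: openI|].
have Gx : {ptws, (\val @ G) --> (\val x : int -> E)}.
  apply/cvg_sup => t U; rewrite nbhsE => -[_ [[Q oQ <-] Qx] QU].
  exists (cyl Om t Q); last by move=> w wQ; exact: QU.
  by split => //; [exact: local_cyl (sub_gen_smallest oQ)|exact: open_cyl].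
rewrite nbhsE => -[_ [ [Q oO <-] /= Op] OW].
have [V [lV oV Vx] VO] := Gx Q (open_nbhs_nbhs (conj oO Op)).
by exists V; split => //; apply: subset_trans OW.
Qed.

(** Continuity makes a function that is nearly constant near each point; by
    compactness finitely many local events suffice to carry these constants. *)
Lemma continuous_local_approx (G : conf Om -> R) : compact (adm Om) ->
  continuous G -> unif_approx local_event G.
Proof.
move=> /compact_conf; rewrite compact_cover => cOm cG e e0.
have H x : exists V, [/\ local_event V, open V, V x &
    forall y, V y -> `|G x - G y| <= e].
  have /cvgrPdist_le /(_ e e0) Gx : G y @[y --> x] --> G x by exact: cG.
  have [V [lV oV Vx VW]] := nbhs_local_event Gx.
  by exists V; split.
have [V HV] := choice H.
have [||D _ Dcov] := cOm (conf Om) setT V.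
- by move=> x _; have [] := HV x.
- by move=> x _; exists x => //; have [] := HV x.
pose s := enum_fset D.
(* The cover is made disjoint by removing from each set the previous ones. *)
pose B i := V (nth point s i) `\` \bigcup_(j in `I_i) V (nth point s j).
have lV i : local_event (V i) by have [] := HV i.
have lB i : local_event (B i).
  apply: local_eventD => //; elim: i => [|i IH].
    by rewrite II0 bigcup_set0; exact: local_event0.
  rewrite IIS bigcup_setU bigcup_set1; exact: local_eventU.
exists (size s), B, (fun i => G (nth point s i)); split => // x.
suff K n : (n <= size s)%N -> (\bigcup_(j in `I_n) V (nth point s j)) x ->
    `|G x - simple_fun n B (fun i => G (nth point s i)) x| <= e.
  apply: K => //; have [z /= zD Vzx] := Dcov x I.
  exists (index z s) => /=; first by rewrite index_mem.
  by rewrite nth_index.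
elim: n => [|n IH] ns; first by rewrite II0 bigcup_set0.
have [xn _|xn] := pselect ((\bigcup_(j in `I_n) V (nth point s j)) x).
  rewrite /simple_fun big_ord_recr/= indicE memNset ?mulr0 ?addr0.
    exact: IH (ltnW ns) xn.
  by case.
rewrite IIS bigcup_setU bigcup_set1 => -[//|Vx].
rewrite /simple_fun big_ord_recr/= indicE mem_set// mulr1 big1 ?add0r.
  have [_ _ _ VG] := HV (nth point s n).
  by rewrite distrC; exact: VG.
move=> i _; rewrite indicE memNset ?mulr0// => -[Vix _]; apply: xn.
by exists i => //=; exact: ltn_ord.
Qed.

Lemma dini (phi : nat -> conf Om -> \bar R) (e : R) : compact (adm Om) ->
  (forall n, continuous (phi n)) ->
  (forall m n x, (m <= n)%N -> (phi n x <= phi m x)%E) ->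
  (forall x, exists n, (phi n x < e%:E)%E) ->
  exists n, forall x, (phi n x < e%:E)%E.
Proof.
move=> /compact_conf /compact_near_coveringP cOm cphi dphi phie.
have := cOm nat \oo (fun n x => (phi n x < e%:E)%E) _.
case=> [x _|n _ H]; last by exists n => x; apply: H => //=.
have [n nx] := phie x.
exists ([set y | (phi n y < e%:E)%E], [set m | (n <= m)%N]).
  split; last by exists n.
  apply: open_nbhs_nbhs; split => //.
  suff : open (phi n @^-1` [set y | (y < e%:E)%E]) by [].
  by apply: open_comp => [? _|]; [exact: cphi|exact: open_ereal_lt_ereal].
by move=> [y m] [/= hy nm]; exact: le_lt_trans (dphi _ _ _ nm) hy.
Qed.

(** The probabilities of the decreasing events are continuous functions of the
    boundary condition and tend to 0 pointwise, so Dini's theorem applies. *)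
Lemma lis_dini (f : lis Om) (a b : int) (A : nat -> set (conf Om)) (e : R) :
  compact (adm Om) -> continuous_lis f -> a <= b -> 0 < e ->
  (forall n, mF Om `[a, b] (A n)) -> (forall m n, (m <= n)%N -> A n `<=` A m) ->
  \bigcap_n A n = set0 -> exists n, forall x, (f a b x (A n) < e%:E)%E.
Proof.
move=> cOm cf ab e0 mA dA A0.
have mA' n : mF Om `]-oo, b] (A n).
  by apply: mF_sub (mA n) => i /=; rewrite !in_itv/= => /andP[].
apply: dini => //.
- by move=> n; exact: cf.
- move=> m n x mn; apply: (@le_measure _ _ _ (f a b x) (A n) (A m)).
  + exact: mem_set (mA' n).
  + exact: mem_set (mA' m).
  + exact: dA.
- move=> x.
  have : f a b x (A n) @[n --> \oo] --> f a b x (\bigcap_n A n).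
    apply: nonincreasing_cvg_mu => //.
    + by rewrite -ge0_fin_numE// fin_num_measure.
    + exact: (@bigcapT_measurable _ (Fsp Om `]-oo, b])).
    + by move=> m n mn; apply/subsetPset; exact: dA.
  rewrite A0 measure0 => /(_ [set y | (y < e%:E)%E]).
  case.
    apply: open_nbhs_nbhs; split; first exact: open_ereal_lt_ereal.
    by rewrite /= lte_fin.
  by move=> n _ /(_ n (leqnn n)) /= ?; exists n.
Qed.

End configuration_space.

Arguments local_event {R E Om} _.

(** * Extending a set function from the local events *)

(** An alias that carries the algebra of local events as its family of
    measurable sets. *)
Definition local_space (R : realType) (E : metricType R) (Om : confSpace E) :
  Type :=
  conf Om.

Section local_algebra.
Context (R : realType) (E : metricType R) (Om : confSpace E).

HB.instance Definition _ := Pointed.on (local_space Om).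
HB.instance Definition _ := @isAlgebraOfSets.Build default_measure_display
  (local_space Om) (@local_event R E Om) (local_event0 Om)
  (@local_eventU R E Om) (@local_eventC R E Om).

End local_algebra.

Section closed_neighbourhoods.
Context (R : realType) (E : metricType R).

Definition thickening (C : set E) (n : nat) : set E :=
  [set x | exists2 y, C y & mdist y x < n.+1%:R^-1].

Lemma open_thickening C n : open (thickening C n).
Proof.
rewrite openE => x [y Cy yx]; rewrite /interior -nbhs_ballE.
exists (n.+1%:R^-1 - mdist y x); first by rewrite /= subr_gt0.
move=> z; rewrite ballEmdist/= ltrBrDl => xz; exists y => //.
exact: le_lt_trans (metric_triangle _ _ _) xz.
Qed.

Lemma sub_thickening C n : C `<=` thickening C n.
Proof. by move=> x Cx; exists x => //; rewrite mdistxx. Qed.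

Lemma thickeningS C m n : (m <= n)%N -> thickening C n `<=` thickening C m.
Proof.
move=> mn x [y Cy yx]; exists y => //; apply: lt_le_trans yx _.
by rewrite lef_pV2 ?posrE// ler_nat.
Qed.

Lemma bigcap_thickening C : closed C -> \bigcap_n thickening C n = C.
Proof.
move=> cC; apply/seteqP; split => x; last by move=> Cx n _; exact:
  sub_thickening.
move=> xC; apply: cC => B; rewrite -nbhs_ballE => -[e /= e0 eB].
have [n ne] : exists n : nat, n.+1%:R^-1 < e.
  exists (Num.bound e^-1); rewrite invf_plt ?posrE//.
  apply: lt_le_trans (archi_boundP _) _; first by rewrite invr_ge0 ltW.
  by rewrite ler_nat.
have [y Cy yx] := xC n I; exists y; split => //; apply: eB.
by rewrite ballEmdist/= metric_sym (lt_trans yx).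
Qed.

End closed_neighbourhoods.

Lemma sum_geometric_half (R : realType) (e : R) n :
  \sum_(i < n) e / 2 ^+ i.+1 = e - e / 2 ^+ n.
Proof.
elim: n => [|n IH]; first by rewrite big_ord0 expr0 divr1 subrr.
rewrite big_ord_recr/= IH exprS invfM.
have : 2 ^+ n != 0 :> R by rewrite expf_neq0.
by move=> ?; field.
Qed.

(** Let [nu] be finitely additive on the local events, and continuous at the
    empty set along sequences of events of one and the same window. Inner
    regularity and compactness give continuity at the empty set along all
    sequences of local events, and Caratheodory's theorem does the rest. *)
Section extension.
Context (R : realType) (E : metricType R) (Om : confSpace E).
Hypothesis cOm : compact (adm Om).
Variable nu : set (conf Om) -> R.
Hypothesis nu_ge0 : forall A, local_event A -> 0 <= nu A.
Hypothesis nuT : nu setT = 1.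
Hypothesis nuU : forall A B, local_event A -> local_event B ->
  A `&` B = set0 -> nu (A `|` B) = nu A + nu B.
Hypothesis nu_window : forall m (A : nat -> set (conf Om)) (e : R),
  (forall n, mF Om (window m) (A n)) ->
  (forall n k, (n <= k)%N -> A k `<=` A n) -> \bigcap_n A n = set0 -> 0 < e ->
  exists n, nu (A n) <= e.

Let nu0 : nu set0 = 0.
Proof.
have := nuU (local_event0 Om) (local_event0 Om) (setI0 _).
by rewrite setU0 => /eqP; rewrite -subr_eq subrr eq_sym => /eqP.
Qed.

Let nuDE A B : local_event A -> local_event B -> B `<=` A ->
  nu A = nu B + nu (A `\` B).
Proof.
move=> lA lB BA; rewrite -nuU//; first by rewrite setDUK.
- exact: local_eventD.
- by rewrite setDE setICA setICr setI0.
Qed.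

Let nu_mono A B : local_event A -> local_event B -> B `<=` A -> nu B <= nu A.
Proof.
by move=> lA lB BA; rewrite (nuDE lA lB BA) lerDl nu_ge0//; exact: local_eventD.
Qed.

Let nu_subadd A B : local_event A -> local_event B ->
  nu (A `|` B) <= nu A + nu B.
Proof.
move=> lA lB; rewrite (nuDE (local_eventU lA lB) lA (@subsetUl _ _ _)) lerD2l.
apply: nu_mono => //; first by apply: local_eventD => //; exact: local_eventU.
by move=> x [[]].
Qed.

Let local_bigcup n (B : nat -> set (conf Om)) : (forall i, local_event (B i)) ->
  local_event (\bigcup_(i in `I_n) B i).
Proof.
move=> lB; elim: n => [|n IH]; first by rewrite II0 bigcup_set0; exact:
  local_event0.
by rewrite IIS bigcup_setU bigcup_set1; exact: local_eventU.
Qed.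

Let nu_subadd_big n (B : nat -> set (conf Om)) :
  (forall i, local_event (B i)) ->
  nu (\bigcup_(i in `I_n) B i) <= \sum_(i < n) nu (B i).
Proof.
move=> lB; elim: n => [|n IH]; first by rewrite II0 bigcup_set0 big_ord0 nu0.
rewrite IIS bigcup_setU bigcup_set1 big_ord_recr/=.
by rewrite (le_trans (nu_subadd _ _))//; [exact: local_bigcup|rewrite lerD2r].
Qed.

(** Approximation is asked from both sides because complementation exchanges
    them: this makes the regular events a sigma-algebra. *)
Let regular (m : nat) (A : set (conf Om)) : Prop := forall e : R, 0 < e ->
  exists C U,
  [/\ mF Om (window m) C, mF Om (window m) U, closed C, open U &
    [/\ C `<=` A, A `<=` U & nu (U `\` C) <= e]].

Let mD m A B : mF Om (window m) A -> mF Om (window m) B ->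
  mF Om (window m) (A `\` B).
Proof. exact: (@measurableD _ (Fsp Om (window m))). Qed.

Let regularC m A : regular m A -> regular m (~` A).
Proof.
move=> rA e e0; have [C [U [mC mU' cC oU [CA AU le]]]] := rA e e0.
exists (~` U), (~` C); split.
- exact: (@measurableC _ (Fsp Om (window m))).
- exact: (@measurableC _ (Fsp Om (window m))).
- exact: open_closedC.
- exact: closed_openC.
- split; [exact: subsetC|exact: subsetC|].
  by rewrite setDE setCK setIC -setDE.
Qed.

Let regular_bigcup m (F : nat -> set (conf Om)) : (forall i, regular m (F i)) ->
  regular m (\bigcup_i F i).
Proof.
move=> rF e e0.
have H i := rF i (e / 2 / 2 ^+ i.+1)
  (divr_gt0 (divr_gt0 e0 (ltr0Sn _ 1)) (exprn_gt0 _ (ltr0Sn _ 1))).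
have [C HC] := choice H; have [U HU] := choice HC.
have mC i : mF Om (window m) (C i) by have [] := HU i.
have mU' i : mF Om (window m) (U i) by have [] := HU i.
have mbU n : mF Om (window m) (\bigcup_(i in `I_n) U i).
  by apply: (@bigcup_measurable _ (Fsp Om (window m))).
have mbC n : mF Om (window m) (\bigcup_(i in `I_n) C i).
  by apply: (@bigcup_measurable _ (Fsp Om (window m))).
have mUU : mF Om (window m) (\bigcup_i U i).
  by apply: (@bigcupT_measurable _ (Fsp Om (window m))).
have [||||n nuUn] := @nu_window m
    (fun n => \bigcup_i U i `\` \bigcup_(i in `I_n) U i) (e / 2).
- by move=> n; exact: mD.
- move=> n k nk x [Ux nUx]; split => // -[i /= ik Uix]; apply: nUx.
  by exists i => //=; exact: leq_trans nk.
- rewrite -subset0 => x H'; have [[i _ Uix] _] := H' 0%N I.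
  by have [_ ] := H' i.+1 I; apply; exists i => /=.
- by rewrite divr_gt0//.
exists (\bigcup_(i in `I_n) C i), (\bigcup_i U i); split => //.
- apply: closed_bigcup => //; last by move=> i _; have [] := HU i.
- by apply: bigcup_open => i _; have [] := HU i.
split.
- by move=> x [i _ Cx]; exists i => //; have [_ _ _ _ [CF _ _]] := HU i; exact:
  CF.
- by move=> x [i _ Fx]; exists i => //; have [_ _ _ _ [_ FU _]] := HU i; exact:
  FU.
have lUC i : local_event (U i `\` C i) by exists m; exact: mD.
pose V := \bigcup_i U i `\` \bigcup_(i in `I_n) U i.
have lV : local_event V by exists m; exact: mD.
apply: (@le_trans _ _ (nu (V `|` \bigcup_(i in `I_n) (U i `\` C i)))).
  apply: nu_mono.
  - by apply: local_eventU => //; exact: local_bigcup.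
  - by exists m; exact: mD.
  - move=> x [Ux nCx]; have [[i ni Uix]|nUx] :=
    pselect ((\bigcup_(i in `I_n) U i) x).
      by right; exists i => //; split => // Cix; apply: nCx; exists i.
    by left.
rewrite (le_trans (nu_subadd _ _))//; first exact: local_bigcup.
rewrite [leRHS]splitr lerD//.
apply: le_trans (nu_subadd_big _ lUC) _.
apply: (@le_trans _ _ (\sum_(i < n) e / 2 / 2 ^+ i.+1)).
  by apply: ler_sum => i _; have [_ _ _ _ []] := HU i.
by rewrite sum_geometric_half gerBl !divr_ge0// ?exprn_ge0// ltW.
Qed.

(** One-site events over a closed set are regular, as the intersection of the
    thickenings of that set. *)
Let regular_window m A : mF Om (window m) A -> regular m A.
Proof.
have regular0 : regular m set0.
  move=> e e0; exists set0, set0; split.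
  - exact: (@measurable0 _ (Fsp Om (window m))).
  - exact: (@measurable0 _ (Fsp Om (window m))).
  - exact: closed0.
  - exact: open0.
  - by split => //; rewrite setD0 nu0 ltW.
apply: smallest_sub.
  split => //; first by move=> B; rewrite setTD; exact: regularC.
  exact: regular_bigcup.
move=> _ [i [mi [B mB ->]]].
have sB : sigma_algebra setT [set B | regular m (cyl Om i B)].
  split => /=; first exact: regular0.
  - by move=> D; rewrite setTD; exact: regularC.
  - by move=> F; exact: regular_bigcup.
apply: (smallest_sub sB _ mB) => U oU /=; rewrite -(setCK U).
apply: (@regularC _ (cyl Om i (~` U))).
have cC := open_closedC oU; move: (~` U) cC => C cC e e0.
have mC : mF Om (window m) (cyl Om i C) by apply: mF_cyl => //; exact:
  borel_closed.
have mN n : mF Om (window m) (cyl Om i (thickening C n)).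
  by apply: mF_cyl => //; apply: sub_gen_smallest; exact: open_thickening.
have [|||//|n le] := @nu_window m
    (fun n => cyl Om i (thickening C n) `\` cyl Om i C) e.
- by move=> n; exact: mD.
- by move=> n k nk x [Ux nCx]; split => //; exact: thickeningS nk _ Ux.
- rewrite -subset0 => x H; have [_ nC] := H 0%N I; apply: nC.
  by rewrite /cyl/= -(bigcap_thickening cC) => n _; have [] := H n I.
exists (cyl Om i C), (cyl Om i (thickening C n)); split => //.
- exact: closed_cyl.
- by apply: open_cyl; exact: open_thickening.
- by split => // x Cx; exact: sub_thickening.
Qed.

(** Compactness of the configuration space enters here: inner regularity
    replaces the events by closed ones, which cannot decrease to the empty set
    without one of the finite intersections being empty. *)
Let nu_vanish (A : nat -> set (conf Om)) (e : R) :
  (forall n, local_event (A n)) ->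
  (forall n k, (n <= k)%N -> A k `<=` A n) -> \bigcap_n A n = set0 -> 0 < e ->
  exists n, nu (A n) <= e.
Proof.
move=> lA dA A0 e0.
have H i : exists C, [/\ local_event C, closed C, C `<=` A i &
    nu (A i `\` C) <= e / 2 ^+ i.+1].
  have [m mA] := lA i.
  have [|C [U [mC mU' cC oU [CA AU le]]]] :=
    regular_window mA (e := e / 2 ^+ i.+1).
    by rewrite divr_gt0// exprn_gt0.
  exists C; split => //; first by exists m.
  apply: le_trans le; apply: nu_mono;
    [exists m; exact: mD|exists m; exact: mD|].
  by apply: setSD.
have [C HC] := choice H.
have /compact_near_coveringP cT := compact_conf cOm.
have [x _|N _ HN] := cT nat \oo (fun n x => exists2 j, (j < n)%N & ~ C j x) _.
  have [j nCx] : exists j, ~ C j x.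
    apply: contrapT => /forallNP nC.
    have : (\bigcap_n A n) x.
      by move=> n _; have [_ _ CA _] := HC n; apply: CA; apply: contrapT; exact:
        nC.
    by rewrite A0.
  exists (~` C j, [set m | (j < m)%N]); last first.
    by move=> [y m] [/= hy jm]; exists j.
  split; last by exists j.+1.
  apply: open_nbhs_nbhs; split => //; apply: closed_openC.
  by have [] := HC j.
exists N.
have lAC i : local_event (A i `\` C i).
  by apply: local_eventD => //; have [] := HC i.
apply: (@le_trans _ _ (nu (\bigcup_(i in `I_N) (A i `\` C i)))).
  apply: nu_mono => //; first exact: local_bigcup.
  move=> x Ax; have [j jN nCx] := HN N (leqnn N) x I.
  by exists j => //; split => //; exact: (dA j N (ltnW jN)).
apply: le_trans (nu_subadd_big _ lAC) _.
apply: (@le_trans _ _ (\sum_(i < N) e / 2 ^+ i.+1)).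
  by apply: ler_sum => i _; have [] := HC i.
by rewrite sum_geometric_half gerBl !divr_ge0// ?exprn_ge0// ltW.
Qed.

(* The absolute value only serves to make the set function nonnegative on all
   sets, as contents are required to be. *)
Let nuE (A : set (local_space Om)) : \bar R := (`|nu A|)%:E.

Let nuE0 : nuE set0 = 0%E. Proof. by rewrite /nuE nu0 normr0. Qed.

Let nuE_ge0 A : (0 <= nuE A)%E. Proof. by rewrite lee_fin. Qed.

Let nuE_additive : semi_sigma_additive nuE.
Proof.
move=> F mF tF mUF.
have lU n : local_event (\bigcup_(i in `I_n) F i) by exact: local_bigcup.
have sumE n : (\sum_(0 <= i < n) nuE (F i) =
  (nu (\bigcup_(i in `I_n) F i))%:E)%E.
  elim: n => [|n IH]; first by rewrite big_geq// II0 bigcup_set0 nu0.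
  rewrite big_nat_recr//= IH /nuE ger0_norm; last exact: (nu_ge0 (mF n)).
  rewrite IIS bigcup_setU bigcup_set1 (nuU (lU n) (mF n))//.
  rewrite -subset0 => x [[i /= ni Fi] Fn].
  move/trivIsetP : tF => /(_ i n I I); rewrite (ltn_eqF ni) => /(_ isT) Fin.
  by have : (F i `&` F n) x by []; rewrite Fin.
rewrite (_ : (fun n => _) = EFin \o (fun n => nu (\bigcup_(i in `I_n) F i))).
  apply: cvg_EFin; first by exact: nearW.
  rewrite /nuE ger0_norm; last exact: (nu_ge0 mUF).
  apply/cvgrPdist_le => e e0.
  have [||||N le] := @nu_vanish
      (fun n => \bigcup_i F i `\` \bigcup_(i in `I_n) F i) e.
  - by move=> n; exact: local_eventD.
  - move=> n k nk x [Fx nFx]; split => // -[i /= ik Fix]; apply: nFx.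
    by exists i => //=; exact: leq_trans nk.
  - rewrite -subset0 => x H'; have [[i _ Fix] _] := H' 0%N I.
    by have [_ ] := H' i.+1 I; apply; exists i => /=.
  - exact: e0.
  have sub n : \bigcup_(i in `I_n) F i `<=` \bigcup_i F i.
    by move=> x [i _ Fi]; exists i.
  exists N => // n /= Nn;
    rewrite (nuDE mUF (lU n) (sub n)) [X in X - _]addrC addrK.
  rewrite ger0_norm; last by apply: nu_ge0; exact: local_eventD.
  apply: le_trans le; apply: nu_mono; [exact: local_eventD..|].
  move=> x [Fx nFx]; split => // -[i /= iN Fi]; apply: nFx.
  by exists i => //=; exact: leq_trans Nn.
by apply/funext => n; exact: sumE.
Qed.

Let nu_content : {measure set (local_space Om) -> \bar R} :=
  HB.pack nuE (isMeasure.Build _ _ _ nuE nuE0 nuE_ge0 nuE_additive).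

Let P (A : set (Fsp Om setT)) : \bar R := measure_extension nu_content A.

Let sub_ext A : mF Om setT A ->
  @measurable _ (g_sigma_algebraType (@measurable _ (local_space Om))) A.
Proof.
apply: smallest_sub; first exact: smallest_sigma_algebra.
move=> _ [i [_ [B mB ->]]]; apply: sub_gen_smallest; exact: local_cyl.
Qed.

Let P_local A : local_event A -> P A = (nu A)%:E.
Proof.
move=> lA; rewrite /P /measure_extension measurable_mu_extE//=.
by rewrite /nuE ger0_norm// nu_ge0.
Qed.

Let P_additive : semi_sigma_additive P.
Proof.
move=> F mF tF mUF.
apply: (@measure_semi_sigma_additive _ _ _ (measure_extension nu_content)) =>
  //.
- by move=> i; exact: sub_ext.
- exact: sub_ext.
Qed.

Lemma local_event_extension : exists mu : probability (Fsp Om setT) R,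
  forall A, local_event A -> mu A = (nu A)%:E.
Proof.
have P0 : P set0 = 0%E by rewrite P_local ?nu0//; exact: local_event0.
have Pge0 A : (0 <= P A)%E by exact: mu_ext_ge0.
have PT : P setT = 1%E by rewrite P_local ?nuT//; exact: local_eventT.
pose mP := isMeasure.Build _ _ _ P P0 Pge0 P_additive.
pose mu0 : {measure set (Fsp Om setT) -> \bar R} := HB.pack P mP.
pose mu : probability (Fsp Om setT) R :=
  HB.pack P mP (Measure_isProbability.Build _ _ _ mu0 PT).
by exists mu => A; exact: P_local.
Qed.

End extension.

(** * Infinite-volume limits and uniqueness *)

(** A cluster point exists by compactness of [0, 1], and an ultrafilter
    converges to each of its cluster points. *)
Lemma ultra_bounded_cvg (R : realType) (T : Type) (U : set_system T)
  (v : T -> R) :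
  UltraFilter U -> (forall t, 0 <= v t <= 1) -> cvg (v @ U).
Proof.
move=> UU v01.
have vU : (v @ U) `[0, 1]%classic.
  rewrite /nbhs/=; apply: filterS filterT => t _ /=.
  by rewrite in_itv/=; exact: v01.
have [p [_ clp]] := @segment_compact R 0 1 (v @ U) _ vU.
apply/cvg_ex; exists p => B pB.
have [//|nB] := in_ultra_setVsetC (v @^-1` B) UU.
by have [r [nBr Br]] := clp (~` B) B nB pB.
Qed.

Section restriction.
Context (R : realType) (E : metricType R) (Om : confSpace E).

Lemma local_window (a b : int) (A : set (conf Om)) :
  mF Om `[a, b] A -> local_event A.
Proof.
move=> mA; exists (maxn `|a| `|b|); apply: mF_sub mA => i.
by rewrite /window/= !in_itv/=; lia.
Qed.

Lemma window_past (m : nat) (b : int) (A : set (conf Om)) : m%:Z <= b ->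
  mF Om (window m) A -> mF Om `]-oo, b] A.
Proof.
by move=> mb; apply: mF_sub => i; rewrite /window/= !in_itv/=; lia.
Qed.

Lemma restricted_measure S (P : {measure set (Fsp Om setT) -> \bar R}) :
  exists q : {measure set (Fsp Om S) -> \bar R}, forall A, q A = P A.
Proof.
have sub A : mF Om S A -> mF Om setT A by exact: mF_sub.
pose q (A : set (Fsp Om S)) := P A.
have q0 : q set0 = 0%E by exact: measure0.
have qge0 A : (0 <= q A)%E by exact: measure_ge0.
have qadd : semi_sigma_additive q.
  move=> F mF tF mUF; apply: (@measure_semi_sigma_additive _ _ _ P) => //.
    by move=> i; exact: sub (mF i).
  exact: sub.
pose m : {measure set (Fsp Om S) -> \bar R} :=
  HB.pack q (isMeasure.Build _ _ _ q q0 qge0 qadd).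
by exists m.
Qed.

Lemma mixture_measure (f : lis Om) (a b : int)
  (P : probability (Fsp Om setT) R) : a <= b ->
  exists q : {measure set (Fsp Om `]-oo, b]) -> \bar R}, forall A, q A =
    (\int[P]_w f a b w A)%E.
Proof.
move=> ab.
pose q (A : set (Fsp Om `]-oo, b])) := (\int[P]_w f a b w A)%E.
have q0 : q set0 = 0%E.
  by rewrite /q; under eq_integral do rewrite measure0; rewrite integral0.
have qge0 A : (0 <= q A)%E by apply: integral_ge0.
have mq A : mF Om `]-oo, b] A -> mfun Om setT (fun w => f a b w A).
  by move=> mA; apply: mfun_sub (lis_measurable f ab mA).
have qadd : semi_sigma_additive q.
  move=> F mF tF mUF.
  rewrite [X in _ --> X](_ : _ = \sum_(0 <= i <oo) q (F i))%E.
    exact: is_cvg_nneseries.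
  rewrite /q -integral_nneseries//; last by move=> n; exact: mq.
  by apply: eq_integral => w _; rewrite measure_semi_bigcup.
pose m : {measure set (Fsp Om `]-oo, b]) -> \bar R} :=
  HB.pack q (isMeasure.Build _ _ _ q q0 qge0 qadd).
by exists m.
Qed.

End restriction.

(** Along the ultrafilter [U], the kernels of the windows [[-n, n]] with
    boundary condition [w] have a limit on every local event; it is shown to
    extend to a consistent probability. *)
Section infinite_volume_limit.
Context (R : realType) (E : metricType R) (Om : confSpace E) (f : lis Om).
Hypothesis cOm : compact (adm Om).
Hypothesis cf : continuous_lis f.
Variables (U : set_system nat) (w : conf Om).
Hypothesis UU : UltraFilter U.
Hypothesis Uoo : \oo `<=` U.

Let Unear m : U [set n | (m <= n)%N].
Proof. by apply: Uoo; exists m. Qed.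

(* The kernel is bounded by 1 on the past of [n]; truncation makes the limit
   exist on arbitrary sets. *)
Let u (A : set (conf Om)) (n : nat) : R := Num.min 1 (fine (f (- n%:Z) n w A)).

Let nu A := lim (u A @ U).

Let le_Nn (n : nat) : - n%:Z <= n :> int. Proof. lia. Qed.

Let uE (n : nat) A : mF Om `]-oo, n%:Z] A -> u A n = fine (f (- n%:Z) n w A).
Proof.
move=> mA; rewrite /u; apply/min_idPr.
rewrite -lee_fin fineK ?fin_num_measure//; exact: probability_le1.
Qed.

Let u01 A n : 0 <= u A n <= 1.
Proof. by rewrite /u ge_min lexx/= le_min ler01 fine_ge0. Qed.

Let cvg_nu A : u A @ U --> nu A.
Proof. exact: ultra_bounded_cvg. Qed.

Let u_app m A n : mF Om (window m) A -> (m <= n)%N ->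
  lis_app f (- n%:Z) n \1_A w = u A n.
Proof.
move=> mA mn; have mA' : mF Om `]-oo, n%:Z] A by apply: window_past mA; lia.
by rewrite lis_app_indic// uE.
Qed.

Let nu_ge0 A : 0 <= nu A.
Proof.
apply: limr_ge; first exact: ultra_bounded_cvg.
by apply: nearW => n; have /andP[] := u01 A n.
Qed.

Let nuT : nu setT = 1.
Proof.
rewrite /nu (_ : u setT = cst 1); first exact: lim_cst.
apply/funext => n; rewrite uE; last exact:
  (@measurableT _ (Fsp Om `]-oo, n%:Z])).
by rewrite (_ : f _ _ _ _ = 1%E)//; exact: probability_setT.
Qed.

Let nuU A B : local_event A -> local_event B -> A `&` B = set0 ->
  nu (A `|` B) = nu A + nu B.
Proof.
move=> [m mA] [m' mB] AB0; apply/cvg_lim => //.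
apply: cvg_trans (cvgD (cvg_nu (A:=A)) (cvg_nu (A:=B))).
apply: near_eq_cvg; apply: filterS (Unear (maxn m m')) => n /= mn.
have mA' : mF Om `]-oo, n%:Z] A by apply: window_past mA; lia.
have mB' : mF Om `]-oo, n%:Z] B by apply: window_past mB; lia.
have mAB : mF Om `]-oo, n%:Z] (A `|` B).
  exact: (@measurableU _ (Fsp Om `]-oo, n%:Z])).
rewrite -[LHS]/(u A n + u B n) !uE// -fineD ?fin_num_measure//; congr fine.
by apply/esym; exact: measureU.
Qed.

Let indic_le1 A (x : conf Om) : `|\1_A x : R| <= 1.
Proof. by rewrite indicE; case: (_ \in _); rewrite ?normr0 ?normr1. Qed.

(** Seen from far away, a window event has at most the largest probability that
    the kernel of that window can give it, so Dini's theorem applied to the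
    kernels passes to the limit. *)
Let nu_window m (A : nat -> set (conf Om)) (e : R) :
  (forall n, mF Om (window m) (A n)) ->
  (forall n k, (n <= k)%N -> A k `<=` A n) -> \bigcap_n A n = set0 -> 0 < e ->
  exists n, nu (A n) <= e.
Proof.
move=> mA dA A0 e0.
have [n fe] := lis_dini cOm cf (le_Nn m) e0 mA dA A0.
exists n; apply: limr_le; first exact: ultra_bounded_cvg.
apply: filterS (Unear m) => k /= mk.
have mAm : mF Om `]-oo, m%:Z] (A n) by apply: window_past (mA n).
rewrite -(u_app (mA n) mk).
have mAf : mfun Om `]-oo, m%:Z] (\1_(A n) : _ -> R) by exact: measurable_indic.
rewrite -(lis_app_consistent f w _ (le_Nn m) _ mAf (indic_le1 (A n)));
  [|lia|lia].
apply: le_trans (ler_norm _) _; apply: lis_app_bounded.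
  apply: mfun_sub (mfun_lis_app f (le_Nn m) mAf (indic_le1 (A n))).
  by move=> i /=; rewrite !in_itv/=; lia.
move=> x; rewrite lis_app_indic// ger0_norm ?fine_ge0//.
by rewrite -lee_fin fineK ?fin_num_measure// ltW.
Qed.

Let limit_event (P : probability (Fsp Om setT) R) :=
  forall A, local_event A -> u A @ U --> fine (P A).

Let limit_integral P (H : conf Om -> R) (M : R) (N0 : nat) : limit_event P ->
  unif_approx local_event H -> (forall x, `|H x| <= M) ->
  mfun Om `]-oo, N0%:Z] H ->
  (fun n : nat => lis_app f (- n%:Z) n H w) @ U --> \int[P]_x H x.
Proof.
move=> PA apH HM mH; apply/cvgrPdist_le => e e0.
have e30 : 0 < e / 3 by rewrite divr_gt0.
have [N [A0 [c [lA0 A0H]]]] := apH _ e30.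
pose A i := if (i < N)%N then A0 i else set0.
have AH x : `|H x - simple_fun N A c x| <= e / 3.
  rewrite (_ : simple_fun N A c x = simple_fun N A0 c x)//.
  by apply: eq_bigr => i _; rewrite /A ltn_ord.
have lA i : local_event (A i).
  by rewrite /A; case: ifP => _; [exact: lA0|exact: local_event0].
have [m mA] := choice lA.
pose K := maxn N0 (\max_(i < N) m i).
have mAK (n : nat) i : (K <= n)%N -> mF Om `]-oo, n%:Z] (A i).
  move=> Kn; have [iN|iN] := ltnP i N.
    apply: window_past (mA i); have :=
      @leq_bigmax _ (fun i : 'I_N => m i) (Ordinal iN).
    by move=> /= mi; rewrite lez_nat (leq_trans mi)// (leq_trans _ Kn)//
      leq_maxr.
  by rewrite /A ltnNge iN; exact: (@measurable0 _ (Fsp Om `]-oo, n%:Z])).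
have sP : (fun n => \sum_(i < N) c i * u (A i) n) @ U -->
    \int[P]_x simple_fun N A c x.
  rewrite (Rintegral_simple P N c); last first.
    by move=> i; have [k mk] := lA i; exact: mF_sub mk.
  elim: (N) => [|n IH].
    rewrite big_ord0; under eq_fun do rewrite big_ord0; exact: cvg_cst.
  rewrite big_ord_recr; under eq_fun do rewrite big_ord_recr.
  by apply: cvgD => //; apply: cvgMr; exact: PA.
have mHT : mfun Om setT H by apply: mfun_sub mH.
have mST : mfun Om setT (simple_fun N A c).
  apply: (@measurable_simple _ (Fsp Om setT)) => i.
  by have [k mk] := lA i; exact: mF_sub mk.
have hP := @Rintegral_dist_le _ _ _ P _ _ M _ mHT mST HM AH.
move/cvgrPdist_le : sP => /(_ _ e30) sP.
near=> n.
have Kn : (K <= n)%N by near: n; exact: Unear.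
have mHn : mfun Om `]-oo, n%:Z] H.
  by apply: mfun_sub mH; apply: past_sub; move: Kn; rewrite /K; lia.
have mSn : mfun Om `]-oo, n%:Z] (simple_fun N A c).
  by apply: (@measurable_simple _ (Fsp Om `]-oo, n%:Z])) => i; exact: mAK.
have hn : `|lis_app f (- n%:Z) n H w - lis_app f (- n%:Z) n (simple_fun N A c)
  w|
    <= e / 3.
  rewrite /lis_app le_Nn.
  exact: (@Rintegral_dist_le _ _ _ (f (- n%:Z) n w) _ _ M _ mHn mSn HM AH).
have hs : `|\int[P]_x simple_fun N A c x -
    lis_app f (- n%:Z) n (simple_fun N A c) w| <= e / 3.
  rewrite lis_app_simple//; last by move=> i; exact: mAK.
  rewrite (eq_bigr (fun i : 'I_N => c i * u (A i) n)); first by near: n.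
  by move=> i _; rewrite uE//; exact: mAK.
rewrite (_ : _ - _ = (\int[P]_x H x - \int[P]_x simple_fun N A c x) +
  (\int[P]_x simple_fun N A c x - lis_app f (- n%:Z) n (simple_fun N A c) w) -
  (lis_app f (- n%:Z) n H w - lis_app f (- n%:Z) n (simple_fun N A c) w));
    last by ring.
rewrite (le_trans (ler_normB _ _))//.
rewrite (_ : e = e / 3 + e / 3 + e / 3); last by field.
by rewrite lerD// (le_trans (ler_normD _ _))// lerD.
Unshelve. all: by end_near. Qed.

(** It suffices to test rectangles made of a local event [A1] of the strict
    past of the window and of an event [A2] of the window. There the kernel is
    the indicator of [A1] times a continuous function, which is a uniform limit
    of local simple functions, so its mean is a limit along [U] of means under
    the large-window kernels, and these are invariant. *)
Let limit_consistent P : limit_event P -> consistent f P.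
Proof.
move=> PA a b ab A mA.
have [q qE] := mixture_measure f P ab.
have [p pE] := restricted_measure `]-oo, b] P.
rewrite -(qE A) -(pE A); move: A mA.
have sab : `[a, b]%classic `<=` `]-oo, b]%classic.
  by move=> i /=; rewrite !in_itv/= => /andP[].
have sa : `]-oo, a[%classic `<=` `]-oo, b]%classic by apply: strict_past_sub;
  lia.
apply: (@measure_eq_rectangles _ _ Om `]-oo, b]
  [set A | local_event A /\ mF Om `]-oo, a[ A] (mF Om `[a, b])).
- by move=> B [_]; exact: mF_sub.
- by move=> B; exact: mF_sub.
- move=> B C [lB mB] [lC mC]; split; first exact: local_eventI.
  exact: (@measurableI _ (Fsp Om `]-oo, a[)).
- exact: (@measurableI _ (Fsp Om `[a, b])).
- by split; [exact: local_eventT|exact: (@measurableT _ (Fsp Om `]-oo, a[))].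
- exact: (@measurableT _ (Fsp Om `[a, b])).
- move=> i C /=; rewrite in_itv/= => ib cC.
  have [ia|ai] := ltP i a; [left; split|right].
  + by apply: local_cyl; exact: borel_closed.
  + by apply: mF_cyl; [rewrite /= in_itv|exact: borel_closed].
  + by apply: mF_cyl; [rewrite /= in_itv/= ai|exact: borel_closed].
- rewrite qE; apply: le_lt_trans (ltry 1).
  have -> : 1%E = (\int[P]_w 1%:E)%E.
    by rewrite integral_cst// [X in (_ * X)%E]probability_setT mule1.
  apply: ge0_le_integral => //.
  + by apply: mfun_sub
    (lis_measurable f ab (@measurableT _ (Fsp Om `]-oo, b]))).
  + by move=> x _; exact: probability_le1.
move=> A1 A2 [lA1 mA1] mA2.
have lA2 := local_window mA2.
have mA12 : mF Om `]-oo, b] (A1 `&` A2).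
  apply: (@measurableI _ (Fsp Om `]-oo, b])).
    exact: mF_sub mA1.
  exact: mF_sub mA2.
have lA12 := local_eventI lA1 lA2.
rewrite qE pE.
pose G x := fine (f a b x A2).
have mA2' : mF Om `]-oo, b] A2 by exact: mF_sub mA2.
have fG x : f a b x A2 = (G x)%:E.
  by rewrite /G fineK//; apply: (fin_num_measure (f a b x)).
have G01 x : `|G x| <= 1.
  rewrite ger0_norm ?fine_ge0// -lee_fin -fG; exact: probability_le1.
have cG : continuous G.
  move=> x; have : f a b y A2 @[y --> x] --> f a b x A2 by exact: cf.
  by rewrite [X in _ --> X]fG => /fine_cvg.
have apG := continuous_local_approx cOm cG.
pose H x := \1_A1 x * G x.
have HE x : H x = lis_app f a b \1_(A1 `&` A2) x.
  rewrite lis_app_indic// (lis_proper_rect _ _ ab mA1 mA2') fG -EFinM.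
  by rewrite /= /H.
have apH : unif_approx local_event H.
  move=> e e0; have [N [A' [c [lA' A'G]]]] := apG e e0.
  exists N, (fun i => A1 `&` A' i), c; split; first by move=> i; exact:
    local_eventI.
  move=> x; rewrite /H (_ : simple_fun _ _ _ x = \1_A1 x * simple_fun N A' c x).
    by rewrite -mulrBr normrM -[leRHS]mul1r ler_pM.
  rewrite /simple_fun big_distrr/=; apply: eq_bigr => i _.
  by rewrite indicI/= mulrCA.
have H1 x : `|H x| <= 1 by rewrite normrM -[leRHS]mul1r ler_pM.
have m12 : mfun Om `]-oo, b] (\1_(A1 `&` A2) : _ -> R) by exact:
  measurable_indic.
have mHa : mfun Om `]-oo, a[ H.
  rewrite (_ : H = lis_app f a b \1_(A1 `&` A2)); last exact/funext/HE.
  exact: mfun_lis_app m12 (@indic_le1 _).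
have mH : mfun Om `]-oo, (maxn `|a| `|b|)%:Z] H.
  by apply: mfun_sub mHa => i /=; rewrite !in_itv/=; lia.
have cH := limit_integral PA apH H1 mH.
have c12 := PA _ lA12.
have -> : (\int[P]_w f a b w (A1 `&` A2) = (\int[P]_x H x)%:E)%E.
  rewrite -(@EFin_Rintegral _ _ _ P H 1)//; last exact: mfun_sub mH.
  apply: eq_integral => x _; rewrite HE lis_app_indic// fineK//.
  by rewrite fin_num_measure.
rewrite -[RHS]fineK; last first.
  by rewrite fin_num_measure//; have [k mk] := lA12; exact: mF_sub mk.
congr EFin; rewrite -(cvg_lim (@Rhausdorff R) cH); apply/cvg_lim => //.
apply: cvg_trans c12; apply: near_eq_cvg.
have [k mk] := lA12.
apply: filterS (Unear (maxn k (maxn `|a| `|b|))) => n /= kn.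
rewrite -(u_app mk); last by lia.
rewrite -(lis_app_consistent f w _ ab _ m12 (@indic_le1 _)); [|lia|lia].
by congr (lis_app f _ _ _ w); apply/funext => x; rewrite HE.
Qed.

Lemma limit_state : exists P : probability (Fsp Om setT) R, consistent f P /\
  forall (H : conf Om -> R) (M : R) (N0 : nat), unif_approx local_event H ->
    (forall x, `|H x| <= M) -> mfun Om `]-oo, N0%:Z] H ->
    (fun n : nat => lis_app f (- n%:Z) n H w) @ U --> \int[P]_x H x.
Proof.
have [P PE] := local_event_extension cOm (fun A _ => nu_ge0 A) nuT nuU
  nu_window.
have PA : limit_event P by move=> A lA; rewrite PE//=; exact: cvg_nu.
exists P; split; first exact: limit_consistent.
by move=> H M N0; exact: limit_integral.
Qed.

End infinite_volume_limit.

Section convergence.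
Context (R : realType) (E : metricType R) (Om : confSpace E) (f : lis Om).
Hypothesis cOm : compact (adm Om).
Hypothesis cf : continuous_lis f.
Hypothesis fu : has_unique_consistent f.
Variable mu : probability (Fsp Om setT) R.
Hypothesis mu_f : consistent f mu.
Variables (a b : int) (h : conf Om -> R) (M : R).
Hypothesis leab : a <= b.
Hypothesis mh : mfun Om `[a, b] h.
Hypothesis hM : forall x, `|h x| <= M.

Let mhb : mfun Om `]-oo, b] h.
Proof. by apply: mfun_sub mh => i /=; rewrite !in_itv/= => /andP[]. Qed.

(** Otherwise some ultrafilter lives on volumes whose kernels keep the mean of
    [h] away from that under [mu]; the consistent probability that it produces
    would differ from [mu]. *)
Lemma lis_app_cvg (w : conf Om) :
  (fun n : nat => lis_app f (- n%:Z) n h w) @ \oo --> \int[mu]_x h x.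
Proof.
apply/cvgrPdist_lt => e e0.
pose B := [set n : nat | e <= `|\int[mu]_x h x - lis_app f (- n%:Z) n h w|].
suff [N NB] : exists N, forall n, (N <= n)%N -> ~ B n.
  by exists N => // n /NB; rewrite /B/= => /negP; rewrite -ltNge.
apply: contrapT => /forallNP nB.
pose F : set_system nat := within B \oo.
have FF : ProperFilter F.
  apply: Build_ProperFilter_ex => D [N _ ND].
  have /existsNP[n /not_implyP[Nn /contrapT Bn]] := nB N.
  by exists n; exact: ND.
have [U [UU FU]] := ultraFilterLemma FF.
have Uoo : \oo `<=` U.
  by move=> D [N _ ND]; apply: FU; exists N => // n /ND.
have [P [Pf HP]] := limit_state cOm cf w UU Uoo.
have PB : U B by apply: FU; exists 0%N.
have aph : unif_approx local_event h.
  move=> d d0; have [N [A [c [lA Ah]]]] := measurable_unif_approx mh hM d0.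
  by exists N, A, c; split => // i; exact: local_window (lA i).
have mhN : mfun Om `]-oo, `|b|%N%:Z] h.
  by apply: mfun_sub mhb; apply: past_sub; lia.
have /cvgrPdist_lt /(_ _ e0) cU := HP h M _ aph hM mhN.
have Pmu : \int[P]_x h x = \int[mu]_x h x.
  have [mu0 mu0f u] := fu.
  congr fine; apply: eq_measure_integral => A mA _.
  exact: etrans (u P Pf A mA) (esym (u mu mu_f A mA)).
rewrite Pmu in cU.
have [n [/= Bn]] := filter_ex (filterI PB cU).
by rewrite ltNge Bn.
Qed.

Lemma lis_app_mean_cvg (nu : probability (Fsp Om setT) R) :
  (fun n : nat => \int[nu]_w lis_app f (- n%:Z) b h w) @ \oo --> \int[mu]_x h x.
Proof.
(* The shift of [n] makes all windows nonempty. *)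
pose g n w := lis_app f (- (n + (`|a| + `|b|))%N%:Z) b h w.
have nb (n : nat) : - (n + (`|a| + `|b|))%N%:Z <= b by lia.
have gM n w : `|g n w| <= M by exact: lis_app_bounded mhb hM.
have mg n : mfun Om setT (g n) by apply:
  mfun_sub (mfun_lis_app f (nb n) mhb hM).
rewrite -(@cvg_shiftn (`|a| + `|b|) _
  (fun n : nat => \int[nu]_w lis_app f (- n%:Z) b h w)).
have gcvg w : g ^~ w @ \oo --> \int[mu]_x h x.
  have := lis_app_cvg w.
  rewrite -(@cvg_shiftn (`|a| + `|b|)).
  apply: cvg_trans; apply: near_eq_cvg; apply: nearW => n /=.
  by rewrite /g (lis_app_restrict f w (nb n) _ mhb hM)//; lia.
have cst_int : (\int[nu]_w (\int[mu]_x h x)%:E)%E = (\int[mu]_x h x)%:E.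
  by rewrite integral_cst// [X in (_ * X)%E]probability_setT mule1.
have : (\int[nu]_w (g n w)%:E)%E @[n --> \oo] --> (\int[mu]_x h x)%:E.
  rewrite -cst_int.
  apply: (@dominated_cvg _ _ _ nu _ measurableT _ _ (cst M%:E)) => //.
  - by move=> n; exact/measurable_EFinP.
  - by move=> w _; apply: cvg_EFin; [exact: nearW|exact: gcvg].
  - by apply: (@bounded_integrable _ _ _ nu (cst M) `|M|).
  - by move=> n w _; rewrite lee_fin; exact: gM.
by move=> /fine_cvg.
Qed.

End convergence.

(** * Lipschitz functions and one-site laws *)

Definition lipschitz_with (R : realType) (E : metricType R) (L : R) (G : E -> R)
  :=
  forall x y, `|G x - G y| <= L * mdist x y.

(** McShane's extension to [E] of a function known at the points [F t]; for g =
    0 and L = 1 it is the distance to the set of these points. *)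
Definition inf_convolution (R : realType) (E : metricType R) (T : Type)
    (D : set T) (F : T -> E) (g : T -> R) (L : R) (x : E) : R :=
  inf [set g t + L * mdist (F t) x | t in D].

Section inf_convolution.
Context (R : realType) (E : metricType R) (T : Type).
Variables (D : set T) (F : T -> E) (g : T -> R) (L M : R).
Hypotheses (D0 : D !=set0) (L0 : 0 < L) (gM : forall t, D t -> `|g t| <= M).

Let G := inf_convolution D F g L.

Let lb x : lbound [set g t + L * mdist (F t) x | t in D] (- M).
Proof.
move=> _ [t Dt <-]; have /ler_normlP[gt _] := gM Dt.
by have := mulr_ge0 (ltW L0) (mdist_ge0 (F t) x); lra.
Qed.

Let has_inf x : has_inf [set g t + L * mdist (F t) x | t in D].
Proof. by split; [case: D0 => t Dt; exists (g t + L * mdist (F t) x);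
  exists t|exists (- M)]. Qed.

Lemma inf_convolution_le t x : D t -> G x <= g t + L * mdist (F t) x.
Proof. by move=> Dt; apply: ge_inf; [exact: (has_inf x).2|exists t]. Qed.

Lemma inf_convolution_ge x r :
  (forall t, D t -> r <= g t + L * mdist (F t) x) -> r <= G x.
Proof.
move=> rg; apply: lb_le_inf; first exact: (has_inf x).1.
by move=> _ [t Dt <-]; exact: rg.
Qed.

Lemma inf_convolution_lipschitz : lipschitz_with L G.
Proof.
move=> x y; have H u v : G u <= G v + L * mdist u v.
  rewrite -lerBlDr; apply: inf_convolution_ge => t Dt; rewrite lerBlDr.
  apply: le_trans (inf_convolution_le u Dt) _.
  rewrite -addrA lerD2l -mulrDr ler_pM2l// [X in _ <= _ + X]metric_sym.
  exact: metric_triangle.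
by apply/ler_normlP; split; [have := H y x; rewrite metric_sym|have := H x y];
  lra.
Qed.

Lemma inf_convolution_eq t : D t ->
  (forall s, D s -> g t <= g s + L * mdist (F s) (F t)) -> G (F t) = g t.
Proof.
move=> Dt gt; apply/eqP; rewrite eq_le; apply/andP; split.
  by apply: le_trans (inf_convolution_le _ Dt) _; rewrite mdistxx mulr0 addr0.
exact: inf_convolution_ge.
Qed.

Lemma inf_convolution_bounded K x : (forall x y : E, mdist x y <= K) ->
  `|G x| <= M + L * K.
Proof.
move=> dK; have [t Dt] := D0; have K0 : 0 <= K.
  by have := dK x x; rewrite mdistxx.
have LK : 0 <= L * K by rewrite mulr_ge0// ltW.
have /ler_normlP[_ gt] := gM Dt.
apply/ler_normlP; split.
  suff : - M <= G x by lra.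
  by apply: inf_convolution_ge => s Ds; apply: lb; exists s.
apply: le_trans (inf_convolution_le x Dt) _; rewrite lerD// ler_pM2l//.
Qed.

End inf_convolution.

Section lipschitz.
Context (R : realType) (E : metricType R).

Lemma lipschitz_continuous (G : E -> R) L : 0 < L -> lipschitz_with L G ->
  continuous G.
Proof.
move=> L0 lG x; apply/cvgrPdist_lt => e e0.
have : nbhs x (ball x (e / L)) by apply: nbhsx_ballx; rewrite divr_gt0.
apply: filterS => y; rewrite ballEmdist/= => xy.
by rewrite (le_lt_trans (lG x y))// mulrC -ltr_pdivlMr.
Qed.

(** A Lipschitz function between the indicator of [C] and that of its [n]-th
    thickening. *)
Definition bump (C : set E) (n : nat) (x : E) : R :=
  Num.max 0 (1 - n.+1%:R * inf_convolution C id (fun=> 0) 1 x).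

Let dist (C : set E) := inf_convolution C id (fun=> 0) (1 : R).

Let zero_le0 (C : set E) y : C y -> `|0 : R| <= 0.
Proof. by rewrite normr0. Qed.

Lemma bump_lipschitz C n : C !=set0 -> lipschitz_with n.+1%:R (bump C n).
Proof.
move=> C0 x y.
have := inf_convolution_lipschitz id C0 (@ltr01 R) (@zero_le0 C) x y.
rewrite mul1r /bump -/(dist C) => dxy.
have n0 : (0 : R) < n.+1%:R by [].
have {dxy} : `|n.+1%:R * dist C x - n.+1%:R * dist C y| <= n.+1%:R * mdist x y.
  by rewrite -mulrBr normrM gtr0_norm// ler_pM2l.
have := mulr_ge0 (ltW n0) (mdist_ge0 x y).
move: (_ * dist C x) (_ * dist C y) (_ * mdist x y) => p q r r0.
rewrite !ler_norml => /andP[h1 h2].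
by rewrite /Num.max; case: ltP => ?; case: ltP => ?; apply/andP; split; lra.
Qed.

Lemma bump01 C n x : C !=set0 -> 0 <= bump C n x <= 1.
Proof.
move=> C0; rewrite /bump le_max lexx/= ge_max ler01/= gerBl mulr_ge0//.
apply: (@inf_convolution_ge _ _ _ C id (fun=> 0) 1 0 C0 ltr01 (@zero_le0 C)) =>
  t _.
by rewrite add0r mul1r mdist_ge0.
Qed.

Lemma bump_eq1 C n x : C x -> bump C n x = 1.
Proof.
move=> Cx; have C0 : C !=set0 by exists x.
rewrite /bump (@inf_convolution_eq _ _ _ C id (fun=> 0) 1 0 C0 ltr01
  (@zero_le0 C) x Cx).
  by rewrite mulr0 subr0; apply/max_idPr.
by move=> s _; rewrite add0r mul1r mdist_ge0.
Qed.

Lemma bump_eq0 C n x : C !=set0 -> ~ thickening C n x -> bump C n x = 0.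
Proof.
move=> C0 nx; rewrite /bump; apply/max_idPl;
  rewrite subr_le0 -ler_pdivrMl// mulr1.
apply: (@inf_convolution_ge _ _ _ C id (fun=> 0) 1 0 C0 ltr01 (@zero_le0 C)) =>
  t Ct.
rewrite add0r mul1r leNgt; apply/negP => tx; apply: nx; by exists t.
Qed.

End lipschitz.

Section site_laws.
Context (R : realType) (E : metricType R) (Om : confSpace E).
Variable K : R.
Hypothesis dK : forall x y : E, mdist x y <= K.

Lemma mfun_site (G : E -> R) i : continuous G ->
  measurable_fun [set: Bsite Om i] (fun x : Bsite Om i => G (\val x)).
Proof.
move=> cG.
apply: (@measurability _ _ (Bsite Om i) _ setT _ _ (RGenOInfty.measurableE R)).
move=> _ [_ [a ->] <-]; rewrite setTI; apply: sub_sigma_algebra.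
exists (G @^-1` `]a, +oo[%classic) => //.
by apply: open_comp => [? _|]; [exact: cG|exact: interval_open].
Qed.

Lemma Rintegral_site_law (f : lis Om) i w (G : E -> R) (M : R) : continuous G ->
  (forall x, `|G x| <= M) ->
  \int[site_law f i w]_x G (\val x) = \int[f i i w]_x G (spin x i).
Proof.
move=> cG GM; rewrite /Rintegral integral_distribution//.
  by apply/measurable_EFinP; exact: mfun_site.
have mG : mfun Om `]-oo, i] (fun x => G (spin x i)).
  by apply: mfun_spin => //=; rewrite in_itv/=.
exact: (@bounded_integrable _ _ _ (f i i w) _ M mG (fun x => GM _)).
Qed.

(** The distance tests 1-Lipschitz functions, so [G] is divided by [L]. *)
Lemma vkr_dist_lipschitz i (p q : probability (Bsite Om i) R) (G : E -> R)
    (L M r : R) : 0 < L -> lipschitz_with L G -> (forall x, `|G x| <= M) ->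
  (vkr_dist p q <= r%:E)%E ->
  `|\int[p]_x G (\val x) - \int[q]_x G (\val x)| <= L * r.
Proof.
move=> L0 lG GM pq.
have cG := lipschitz_continuous L0 lG.
pose g (x : site Om i) := L^-1 * G (\val x).
have gE (p' : probability (Bsite Om i) R) :
    \int[p']_x g x = L^-1 * \int[p']_x G (\val x).
  rewrite RintegralZl//.
  exact: (@bounded_integrable _ _ _ p' _ M (mfun_site cG) (fun x => GM _)).
have glip x y : `|g x - g y| <= mdist (\val x) (\val y).
  by rewrite -mulrBr normrM gtr0_norm ?invr_gt0// ler_pdivrMl.
suff : (`|\int[p]_x g x - \int[q]_x g x|%:E <= r%:E)%E.
  by rewrite lee_fin !gE -mulrBr normrM gtr0_norm ?invr_gt0// ler_pdivrMl.
apply: le_trans pq; apply: ereal_sup_ubound; exists g; split => //.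
have mg S : S i -> mfun Om S (g \o @toSite _ _ Om i).
  move=> Si; apply: (@measurable_funM _ (Fsp Om S) _ setT (cst L^-1)) => //.
  exact: mfun_spin.
split; first exact: mg.
split; first exact: mg.
apply: le_lt_trans (ltry 1); apply: ge_ereal_sup => _ [j _ <-].
apply: ge_ereal_sup => _ [xi [eta [xe ->]]]; rewrite lee_fin.
have [-> {j xe}|ji] := eqVneq j i.
  have [d0|d0] := eqVneq (mdist (spin xi i) (spin eta i)) 0.
    by rewrite d0 invr0 mulr0.
  have dgt0 : 0 < mdist (spin xi i) (spin eta i).
    by rewrite lt_neqAle eq_sym d0 mdist_ge0.
  by rewrite ler_pdivrMr// mul1r; exact: glip.
rewrite /g /= (xe i I) ?subrr ?normr0 ?mul0r// eq_sym.
exact: ji.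
Qed.

(** When the spins at [j] coincide the difference quotient carries no
    information, and the two values agree because [g] does not look to the
    right of [j]. *)
Lemma osc_le j (g : conf Om -> R) (C : R) (x y : conf Om) :
  (forall x y, (forall i, i <= j -> spin x i = spin y i) -> g x = g y) ->
  (osc `]-oo, j] j g <= C%:E)%E -> (forall i, i < j -> spin x i = spin y i) ->
  `|g x - g y| <= C * mdist (spin x j) (spin y j).
Proof.
move=> gj oC xy; have [d0|d0] := eqVneq (mdist (spin x j) (spin y j)) 0.
  rewrite d0 mulr0 (gj x y) ?subrr ?normr0// => i.
  rewrite le_eqVlt => /orP[/eqP ->|]; last exact: xy.
  exact: mdist_positivity.
have dgt0 : 0 < mdist (spin x j) (spin y j) by rewrite lt_neqAle eq_sym d0
  mdist_ge0.
rewrite -ler_pdivrMr// -lee_fin; apply: le_trans oC; apply: ereal_sup_ubound.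
exists x, y; split => // i; rewrite /= in_itv/= => ij ni.
by apply: xy; rewrite lt_neqAle ni.
Qed.

(** Once the spins to the left of [k] are frozen, [g] is a Lipschitz function
    of the spin at [k], but only on the spins that are admissible next to the
    frozen ones. Its McShane extension is a test function on the whole site and
    has the same integrals, as both kernels are carried by the fibre. *)
Lemma fibre_lipschitz (f ft : lis Om) k w (g : conf Om -> R) (M L r : R) :
  mfun Om `]-oo, k] g -> (forall x, `|g x| <= M) -> 0 < L ->
  (osc `]-oo, k] k g <= L%:E)%E ->
  (vkr_dist (site_law f k w) (site_law ft k w) <= r%:E)%E ->
  `|lis_app f k k g w - lis_app ft k k g w| <= L * r.
Proof.
move=> mg gM L0 oscL vr.
pose D := fibre k w.
have D0 : D !=set0 by exists w.
pose F (x : conf Om) := spin x k.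
have gD x y : D x -> D y -> g x <= g y + L * mdist (F y) (F x).
  move=> Dx Dy; have gk x' y' : (forall i, i <= k -> spin x' i = spin y' i) ->
      g x' = g y'.
    by move=> xy; apply: (mfun_agree mg) => i; rewrite /= in_itv/=; exact: xy.
  have := osc_le gk oscL (fun i ik => etrans (Dy i ik) (esym (Dx i ik))).
  by rewrite distrC ler_norml => /andP[_]; rewrite /F; lra.
pose G := inf_convolution D F g L.
have gM' x : D x -> `|g x| <= M by [].
have lG : lipschitz_with L G := inf_convolution_lipschitz F D0 L0 gM'.
have GM x : `|G x| <= M + L * K := inf_convolution_bounded F D0 L0 gM' x dK.
have GE x : D x -> G (F x) = g x.
  by move=> Dx; apply: (@inf_convolution_eq _ _ _ D F g L M D0 L0 gM') =>
    // s Ds; exact: gD.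
have cG := lipschitz_continuous L0 lG.
have key (f' : lis Om) :
  lis_app f' k k g w = \int[site_law f' k w]_x G (\val x).
  rewrite (Rintegral_site_law _ _ _ cG GM) /lis_app lexx.
  have mG : mfun Om `]-oo, k] (fun x => G (spin x k)).
    by apply: mfun_spin => //=; rewrite in_itv/=.
  apply/eqP; rewrite -subr_eq0 -RintegralB//; first last.
  - exact: (@bounded_integrable _ _ _ (f' k k w) _ _ mG (fun x => GM _)).
  - exact: (@bounded_integrable _ _ _ (f' k k w) _ _ mg gM).
  apply/eqP; apply: (@Rintegral_as_cst _ _ _ (f' k k w) _ _ D).
  - by apply: mF_fibre_le; lia.
  - exact: lis_fibre.
  - exact: measurable_funB.
  - by move=> x Dx; rewrite -/(F x) GE// subrr.
by rewrite !key; exact: vkr_dist_lipschitz lG GM vr.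
Qed.

(** Bump functions decreasing to the indicator of [C] compare the two
    probabilities of the closed set [C]. *)
Let site_le (f ft : lis Om) k w (C : set E) : closed C -> C !=set0 ->
  (forall n, \int[f k k w]_x bump C n (spin x k) =
             \int[ft k k w]_x bump C n (spin x k)) ->
  (f k k w (cyl Om k C) <= ft k k w (cyl Om k C))%E.
Proof.
move=> cC C0 H.
have mT n : mF Om `]-oo, k] (cyl Om k (thickening C n)).
  by apply: mF_cyl; [rewrite /= in_itv/=|apply: sub_gen_smallest;
    exact: open_thickening].
have mC : mF Om `]-oo, k] (cyl Om k C).
  by apply: mF_cyl; [rewrite /= in_itv/=|exact: borel_closed].
have cB n : continuous (bump C n).
  exact: lipschitz_continuous (ltr0Sn _ n) (bump_lipschitz n C0).
have mB n : mfun Om `]-oo, k] (fun x => bump C n (spin x k)).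
  by apply: mfun_spin => //=; rewrite in_itv/=.
have B1 n x : `|bump C n x| <= 1.
  by have /andP[h0 h1] := bump01 n x C0; rewrite ger0_norm.
have iB (f' : lis Om) n :
    (f' k k w).-integrable setT (EFin \o (fun x => bump C n (spin x k))).
  exact: (@bounded_integrable _ _ _ (f' k k w) _ 1 (mB n) (fun x => B1 n _)).
have iI (f' : lis Om) A : mF Om `]-oo, k] A ->
    (f' k k w).-integrable setT (EFin \o (\1_A : _ -> R)).
  move=> mA; apply: (@bounded_integrable _ _ _ (f' k k w) _ 1).
    exact: measurable_indic.
  by move=> x; rewrite indicE; case: (_ \in _); rewrite ?normr0 ?normr1.
have ineq n : (f k k w (cyl Om k C) <= ft k k w (cyl Om k (thickening C n)))%E.
  rewrite -[leLHS]fineK ?fin_num_measure// -[leRHS]fineK ?fin_num_measure//.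
  rewrite lee_fin -!lis_app_indic// /lis_app lexx.
  apply: (@le_trans _ _ (\int[f k k w]_x bump C n (spin x k))).
    apply: le_Rintegral => //; [exact: iI|exact: iB|].
    move=> x _; rewrite indicE; case: (boolP (x \in _)) => [/set_mem Cx|_].
      by rewrite bump_eq1.
    by have /andP[] := bump01 n (spin x k) C0.
  rewrite H; apply: le_Rintegral => //; [exact: iB|exact: iI|].
  move=> x _; rewrite indicE; case: (boolP (x \in _)) => [_|/negP nx].
    by have /andP[] := bump01 n (spin x k) C0.
  by rewrite bump_eq0// => Cx; apply: nx; exact: mem_set.
have cv : ft k k w (cyl Om k (thickening C n)) @[n --> \oo] -->
    ft k k w (\bigcap_n cyl Om k (thickening C n)).
  apply: (@nonincreasing_cvg_mu _ _ _ (ft k k w)) => //.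
  + by rewrite -ge0_fin_numE// fin_num_measure.
  + exact: (@bigcapT_measurable _ (Fsp Om `]-oo, k])).
  + by move=> m n mn; apply/subsetPset => x; exact: thickeningS.
rewrite (_ : \bigcap_n _ = cyl Om k C) in cv; last first.
  rewrite -[in RHS](bigcap_thickening cC); apply/seteqP.
  by split => x xC n _; exact: xC.
rewrite -(cvg_lim _ cv)//; apply: lime_ge; first by apply/cvg_ex; eexists;
  exact: cv.
exact: nearW.
Qed.

(** A vanishing distance between the site laws forces the full one-site kernels
    to agree: Lipschitz functions separate closed sets, and outside the site
    both kernels copy the boundary condition. *)
Lemma site_law_eq (f ft : lis Om) k w :
  (vkr_dist (site_law f k w) (site_law ft k w) <= 0)%E ->
  forall A, mF Om `]-oo, k] A -> f k k w A = ft k k w A.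
Proof.
move=> v0.
have eqB (C : set E) n : C !=set0 -> \int[f k k w]_x bump C n (spin x k) =
    \int[ft k k w]_x bump C n (spin x k).
  move=> C0.
  have lB := bump_lipschitz n C0; have cB :=
    lipschitz_continuous (ltr0Sn _ n) lB.
  have B1 x : `|bump C n x| <= 1.
    by have /andP[h0 h1] := bump01 n x C0; rewrite ger0_norm.
  rewrite -!(Rintegral_site_law _ _ _ cB B1).
  have := vkr_dist_lipschitz (ltr0Sn _ n) lB B1 v0.
  by rewrite mulr0 normr_le0 subr_eq0 => /eqP.
have eqC C : closed C -> f k k w (cyl Om k C) = ft k k w (cyl Om k C).
  move=> cC; have [->|/set0P C0] := eqVneq C set0.
    by rewrite (_ : cyl Om k set0 = set0)// !measure0.
  apply/eqP; rewrite eq_le; apply/andP; split; apply: site_le => // n.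
    exact: eqB.
  by rewrite eqB.
have sk : `]-oo, k[%classic `<=` `]-oo, k]%classic by apply: strict_past_sub;
  lia.
have mC C : closed C -> mF Om `]-oo, k] (cyl Om k C).
  by move=> cC; apply: mF_cyl; [rewrite /= in_itv/=|exact: borel_closed].
apply: (@measure_eq_rectangles _ _ Om `]-oo, k] (mF Om `]-oo, k[)
  [set A | exists2 C, closed C & A = cyl Om k C]).
- by move=> A; exact: mF_sub.
- by move=> _ [C cC ->]; exact: mC.
- exact: (@measurableI _ (Fsp Om `]-oo, k[)).
- by move=> _ _ [C cC ->] [C' cC' ->]; exists (C `&` C') => //; exact: closedI.
- exact: (@measurableT _ (Fsp Om `]-oo, k[)).
- by exists setT => //; exact: closedT.
- move=> i C /=; rewrite in_itv/= le_eqVlt => /orP[/eqP ->|ik] cC.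
    by right; exists C.
  by left; apply: mF_cyl; [rewrite /= in_itv/=|exact: borel_closed].
- by rewrite -ge0_fin_numE// fin_num_measure.
- move=> A1 _ mA1 [C cC ->].
  rewrite [LHS](lis_proper_rect _ _ (lexx k) mA1 (mC C cC)).
  by rewrite [RHS](lis_proper_rect _ _ (lexx k) mA1 (mC C cC)) eqC.
Qed.

End site_laws.

(** * Site-by-site comparison *)

Section comparison.
Context (R : realType) (E : metricType R) (Om : confSpace E).
Variable K : R.
Hypothesis dK : forall x y : E, mdist x y <= K.

Lemma osc_ge0 S j (h : conf Om -> R) : (0 <= osc S j h)%E.
Proof.
apply: ereal_sup_ubound; exists point, point; split => //.
by rewrite subrr normr0 mul0r.
Qed.

Lemma vkr_dist_ge0 i (p q : probability (Bsite Om i) R) : (0 <= vkr_dist p q)%E.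
Proof.
apply: ereal_sup_ubound; exists (fun=> 0); split.
- split; first exact: (@measurable_cst _ _ (Fsp Om [set i])).
  split; first exact: (@measurable_cst _ _ (Fsp Om setT)).
  apply: le_lt_trans (ltry 0); apply: ge_ereal_sup => _ [j _ <-].
  by apply: ge_ereal_sup => _ [xi [eta [_ ->]]]; rewrite subrr normr0 mul0r.
- by move=> x y; rewrite subrr normr0 mdist_ge0.
- by rewrite !Rintegral_prob_cst subrr normr0.
Qed.

Section one_site.
Variables (f ft : lis Om) (bb : int -> conf Om -> R).
Hypothesis bb_meas : forall i : int, mfun Om setT (bb i).
Hypothesis bb_bound : forall (i : int) (w : conf Om),
  (vkr_dist (site_law f i w) (site_law ft i w) <= (bb i w)%:E)%E.
Variable mut : probability (Fsp Om setT) R.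
Hypothesis mut_ft : consistent ft mut.

Lemma bb_ge0 i w : 0 <= bb i w.
Proof. by rewrite -lee_fin; apply:
  le_trans (vkr_dist_ge0 _ _) (bb_bound i w). Qed.

Lemma bb_int_ge0 i : (0 <= \int[mut]_w (bb i w)%:E)%E.
Proof. by apply: integral_ge0 => w _; rewrite lee_fin bb_ge0. Qed.

(** A zero oscillation is the limit of small positive Lipschitz constants. *)
Lemma one_site_pointwise k (g : conf Om -> R) (M L : R) w :
  mfun Om `]-oo, k] g -> (forall x, `|g x| <= M) ->
  osc `]-oo, k] k g = L%:E ->
  `|lis_app f k k g w - lis_app ft k k g w| <= L * bb k w.
Proof.
move=> mg gM oL.
have L0 : 0 <= L by rewrite -lee_fin -oL osc_ge0.
have H (L' : R) : L <= L' -> 0 < L' ->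
    `|lis_app f k k g w - lis_app ft k k g w| <= L' * bb k w.
  move=> LL' L'0; apply: (fibre_lipschitz dK mg gM L'0) => //.
  by rewrite oL lee_fin.
have [L00|Ln] := eqVneq L 0; last by apply: H => //;
  rewrite lt_neqAle eq_sym Ln.
have b0 := bb_ge0 k w.
rewrite L00 mul0r; apply/ler_addgt0Pr => e e0; rewrite add0r.
have b1 : 0 < bb k w + 1 by lra.
apply: le_trans (H (e / (bb k w + 1)) _ _) _.
- by rewrite L00 ltW// divr_gt0.
- exact: divr_gt0.
- by rewrite -mulrA ger_pMr// mulrC ler_pdivrMr// mul1r lerDl.
Qed.


(** As [mut] is invariant under [ft], the left-hand side is the mean of a
    difference of the two one-site kernels. If the oscillation is infinite,
    then either the right-hand side is infinite, or [bb k] vanishes almost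
    everywhere and the kernels agree there. *)
Lemma one_site_comparison k (g : conf Om -> R) (M : R) :
  mfun Om `]-oo, k] g -> (forall x, `|g x| <= M) ->
  ((`|\int[mut]_w g w - \int[mut]_w lis_app f k k g w|)%:E <=
   \int[mut]_w (bb k w)%:E * osc `]-oo, k] k g)%E.
Proof.
move=> mg gM.
rewrite -(consistent_app mut_ft (lexx k) mg gM).
have mf (f' : lis Om) : mfun Om setT (lis_app f' k k g).
  by apply: mfun_sub (mfun_lis_app f' (lexx k) mg gM).
have fM (f' : lis Om) w : `|lis_app f' k k g w| <= M by exact: lis_app_bounded.
have iF (f' : lis Om) : mut.-integrable setT (EFin \o lis_app f' k k g).
  exact: (@bounded_integrable _ _ _ mut _ M (mf f') (fM f')).
have mD : mfun Om setT (fun w => lis_app ft k k g w - lis_app f k k g w).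
  exact: (@measurable_funB _ (Fsp Om setT)).
have mb : mfun Om setT (fun w => (bb k w)%:E) by exact/measurable_EFinP.
case oE : (osc `]-oo, k] k g) => [L| |]; last by have := osc_ge0 `]-oo, k] k g;
  rewrite oE.
- have L0 : 0 <= L by rewrite -lee_fin -oE osc_ge0.
  rewrite muleC -ge0_integralZl//; last by move=> w _; rewrite lee_fin bb_ge0.
  rewrite -RintegralB// EFin_normr_Rintegral//; last first.
    by have := integrableB measurableT (iF ft) (iF f).
  apply: le_trans (le_abse_integral _ measurableT _) _;
    first exact/measurable_EFinP.
  apply: ge0_le_integral => //.
  + by apply: measurableT_comp => //; exact/measurable_EFinP.
  + by apply: emeasurable_funM => //.
  + move=> w _; rewrite -EFinM lee_fin distrC; exact:
    one_site_pointwise mg gM oE.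
have [b0|bn0] := eqVneq (\int[mut]_w (bb k w)%:E)%E 0%E; last first.
  by rewrite gt0_muley ?leey// lt0e bn0 bb_int_ge0.
rewrite b0 mul0e.
suff -> : \int[mut]_w lis_app ft k k g w = \int[mut]_w lis_app f k k g w.
  by rewrite subrr normr0.
have : ae_eq mut setT (fun w => (bb k w)%:E) (cst 0%E).
  apply/(ae_eq_integral_abs _ measurableT mb).
  by under eq_integral do rewrite gee0_abs ?lee_fin ?bb_ge0//.
move=> ae; congr fine; apply: ae_eq_integral => //.
- exact/measurable_EFinP.
- exact/measurable_EFinP.
apply: filterS ae => w /= /(_ I) bw0 _; congr EFin.
rewrite /lis_app lexx; congr fine; apply: eq_measure_integral => A mA _.
by apply/esym; apply: site_law_eq => //; rewrite -[leRHS]bw0; exact: bb_bound.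
Qed.

Section bounded_observable.
Variables (b : int) (h : conf Om -> R) (M : R).
Hypotheses (mh : mfun Om `]-oo, b] h) (hM : forall x, `|h x| <= M).

Let T k := (\int[mut]_w (bb k w)%:E * osc `]-oo, k] k
  (lis_app f (k + 1) b h))%E.

Lemma term_ge0 k : (0 <= T k)%E.
Proof. by rewrite mule_ge0// ?osc_ge0// bb_int_ge0. Qed.

(** Enlarging the window by one site on the left applies the one-site kernel of
    that site to the previous conditional expectation. *)
Lemma telescoping (n : nat) :
  ((`|\int[mut]_w h w - \int[mut]_w lis_app f (b - n%:Z + 1) b h w|)%:E <=
   \sum_(0 <= i < n) T (b - i%:Z))%E.
Proof.
elim: n => [|n IH].
  rewrite big_geq// subr0 (_ : lis_app f (b + 1) b h = h) ?subrr ?normr0//.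
  by apply/funext => w; rewrite /lis_app ifF//; lia.
rewrite big_nat_recr//=; set k := b - n%:Z; set g := lis_app f (k + 1) b h.
have kb : k <= b by rewrite /k; lia.
have gM x : `|g x| <= M by exact: lis_app_bounded.
have mg : mfun Om `]-oo, k] g.
  have [kb'|kb'] := leP (k + 1) b.
    by apply: mfun_sub (mfun_lis_app f kb' mh hM); apply: strict_past_sub.
  have -> : g = h by apply/funext => w; rewrite /g /lis_app ifF//; lia.
  by rewrite (_ : k = b)//; lia.
have -> : lis_app f (b - n.+1%:Z + 1) b h = lis_app f k k g.
  apply/funext => w; rewrite (_ : b - n.+1%:Z + 1 = k); last by rewrite /k; lia.
  have [kb'|kb'] := leP (k + 1) b.
    by rewrite (lis_app_comp f w _ kb' mh hM) ?addrK//; lia.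
  have -> : g = h by apply/funext => x; rewrite /g /lis_app ifF//; lia.
  by rewrite (_ : k = b)//; lia.
apply: le_trans (leeD IH (one_site_comparison mg gM)).
by rewrite -EFinD lee_fin (le_trans _ (ler_normD _ _))// addrA subrK.
Qed.

Lemma sum_le_esum (a : int) (n : nat) : a <= b ->
  (\sum_(0 <= i < n) T (b - i%:Z)%R <= \esum_(k in `[a, b] `|` `]-oo, a[) T
    k)%E.
Proof.
move=> ab.
rewrite (@reindex_esum _ _ _ setT _ (fun i : nat => b - i%:Z)).
- rewrite -nneseries_esumT; last by move=> i; exact: term_ge0.
  by apply: nneseries_lim_ge => i _ _; exact: term_ge0.
- split.
  + by move=> i _ /=; rewrite !in_itv/=; case: (ltP (b - i%:Z) a) => ?;
    [right|left]; lia.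
  + by move=> i j _ _ /addrI /oppr_inj [].
  + move=> k; rewrite /= !in_itv/= => kab; exists `|(b - k)%R|%N => //.
    by case: kab => ?; lia.
Qed.

End bounded_observable.

End one_site.

(** The expectations of [h] over growing windows are compared one site at a
    time: on a fibre each of them moves by at most the oscillation times the
    diameter [K], so its mean over the fibre stays within that distance. *)
Lemma osc_dist_lis_app (f : lis Om) (a b : int) (h : conf Om -> R) :
  mfun Om `]-oo, b] h ->
  (forall k, a <= k <= b -> (osc `]-oo, k] k (lis_app f (k + 1) b h) < +oo)%E)
    ->
  forall n : nat, n%:Z <= b + 1 - a ->
  exists C, forall w, `|h w - lis_app f (b - n%:Z + 1) b h w| <= C.
Proof.
move=> mh oscf; elim=> [|n IH] nab.
  by exists 0 => w; rewrite subr0 /lis_app ifF ?subrr ?normr0//; lia.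
have [|C HC] := IH; first by lia.
set k := b - n%:Z in HC; set g := lis_app f (k + 1) b h in HC.
have ak : a <= k by rewrite /k; lia.
have kb : k <= b by rewrite /k; lia.
have oscg : (osc `]-oo, k] k g < +oo)%E by apply: oscf; rewrite ak.
have [L oE] : exists L : R, osc `]-oo, k] k g = L%:E.
  exists (fine (osc `]-oo, k] k g)); rewrite fineK//.
  by rewrite ge0_fin_numE// osc_ge0.
have L0 : 0 <= L by rewrite -lee_fin -oE osc_ge0.
have gk x y : (forall i, i <= k -> spin x i = spin y i) -> g x = g y.
  move=> xy; have [kb'|kb'] := leP (k + 1) b.
    by apply: lis_app_agree => // i ik; apply: xy; lia.
  have -> : g = h by apply/funext => z; rewrite /g /lis_app ifF//; lia.
  by apply: (mfun_agree mh) => i /=; rewrite in_itv/= => ib; apply: xy; lia.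
have gdist x w : fibre k w x -> `|h x - g w| <= C + L * K.
  move=> xw; rewrite -(subrK (g x) (h x)) -addrA (le_trans (ler_normD _ _))//
    lerD//.
  apply: le_trans (osc_le gk _ xw) _; first by rewrite oE.
  by rewrite ler_wpM2l.
exists (C + (C + L * K)) => w.
rewrite (_ : b - n.+1%:Z + 1 = k); last by rewrite /k; lia.
have [_] : (f k b w).-integrable setT (EFin \o h) /\
    `|\int[f k b w]_x h x - g w| <= C + L * K.
  apply: (@Rintegral_near_cst _ _ _ (f k b w) _ _ _ (fibre k w)) => //.
  - by apply: mF_fibre_le; lia.
  - exact: lis_fibre.
  - by move=> x; exact: gdist.
rewrite /lis_app kb => hg.
rewrite -(subrK (g w) (h w)) -addrA (le_trans (ler_normD _ _))// lerD//
  distrC//.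
Qed.

End comparison.


(** * The comparison theorem *)

(** Dini's theorem gives a level that [h] exceeds with probability less than
    one under every boundary condition; on the fibre of a boundary condition
    [h] is within a fixed distance of its conditional expectation, so the level
    bounds both. *)
Lemma bounded_of_dist_lis_app (R : realType) (E : metricType R)
    (Om : confSpace E) (f : lis Om) (a b : int) (h : conf Om -> R) (C : R) :
  compact (adm Om) -> continuous_lis f -> a <= b -> mfun Om `[a, b] h ->
  (forall w, `|h w - lis_app f a b h w| <= C) ->
  exists M, forall w, `|h w| <= M.
Proof.
move=> cOm cf ab mh hC.
pose A (n : nat) := [set x : conf Om | n%:R <= `|h x|].
have mA n : mF Om `[a, b] (A n).
  rewrite -[X in measurable X]setTI; apply:
    (@measurable_fun_le _ (Fsp Om `[a, b])) => //.
  exact: measurableT_comp.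
have [||N fN] := @lis_dini _ _ _ f a b A 1 cOm cf ab ltr01 mA.
- by move=> m n mn x; apply: le_trans; rewrite ler_nat.
- rewrite -subset0 => x Ax.
  have := archi_boundP (normr_ge0 (h x)); rewrite ltNge => /negP; apply.
  exact: (Ax _ I).
exists (N%:R + C + C) => w.
have sab : `[a, b]%classic `<=` `]-oo, b]%classic.
  by move=> i /=; rewrite !in_itv/= => /andP[].
have [x [xw hx]] : exists x, fibre a w x /\ ~ A N x.
  apply: contrapT => /forallNP nx; have := fN w; rewrite ltNge => /negP; apply.
  rewrite -(lis_fibre f w ab); apply: (@le_measure _ _ _ (f a b w)).
  - by apply: mem_set; apply: mF_fibre_le; lia.
  - by apply: mem_set; exact: mF_sub sab (mA N).
  - by move=> y yw; apply: contrapT => nAy; apply: (nx y).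
have gx : lis_app f a b h x = lis_app f a b h w by exact: lis_app_agree.
have hN : `|h x| < N%:R by rewrite ltNge; exact/negP.
have := hC w; have := hC x; rewrite gx.
move: (lis_app f a b h w) => g h1 h2.
rewrite (_ : h w = (h w - g) - (h x - g) + h x); last by ring.
rewrite (le_trans (ler_normD _ _))// (_ : N%:R + C + C = C + C + N%:R);
  last by ring.
by rewrite lerD ?(ltW hN)// (le_trans (ler_normB _ _))// lerD.
Qed.

(* [hdef]: B_d(Lambda) may contain unbounded functions when Omega is not a
   product.  Bounded h are covered unconditionally, with 0 * +oo = 0 in the sum;
   for unbounded h one asks that no undefined product 0 * +oo occurs in the
   right-hand side at the sites of Lambda = [a, b]. *)
Theorem theorem5p15 (R : realType) (E : metricType R)
    (dbd : exists M : R, forall x y : E, mdist x y <= M)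
    (Om : confSpace E) (Om_compact : compact (adm Om))
    (f ft : lis Om)
    (f_cont : continuous_lis f) (f_uniq : has_unique_consistent f)
    (bb : int -> conf Om -> R)
    (bb_meas : forall i : int, measurable_fun [set: Fsp Om setT] (bb i))
    (bb_bound : forall (i : int) (w : conf Om),
      (vkr_dist (site_law f i w) (site_law ft i w) <= (bb i w)%:E)%E)
    (mu mut : probability (Fsp Om setT) R)
    (mu_f : consistent f mu) (mut_ft : consistent ft mut)
    (a b : int) (leab : a <= b)
    (h : conf Om -> R) (hBd : BdOn `[a, b] h)
    (hdef : (exists M : R, forall w : conf Om, `|h w| <= M) \/
       (forall k : int, a <= k <= b ->
          (\int[mut]_w (bb k w)%:E = 0)%E ->
          (osc `]-oo, k] k (lis_app f (k + 1) b h) < +oo)%E)) :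
  ((`| \int[mu]_w h w - \int[mut]_w h w |)%:E <=
   \esum_(k in `[a, b] `|` `]-oo, a[)
     (\int[mut]_w (bb k w)%:E * osc `]-oo, k] k (lis_app f (k + 1) b h)))%E.

Proof.

have [K dK] := dbd.
have [mh [mhT _]] := hBd.
have mhb : mfun Om `]-oo, b] h.
  by apply: mfun_sub mh => i /=; rewrite !in_itv/= => /andP[].
set T := (X in esum _ X); set S := (X in esum X _).
have T0 k : (0 <= T k)%E by exact: term_ge0 bb_bound mut b h k.
have [->|Tfin] := eqVneq (esum S T) +oo%E; first exact: leey.
have [M hM] : exists M, forall w, `|h w| <= M.
  case: hdef => [//|hfin].
  (* With a finite sum, only terms of the form 0 * +oo could hide an infinite
     oscillation inside the window; [hfin] excludes them. *)
  have oscf k : a <= k <= b -> (osc `]-oo, k] k (lis_app f (k + 1) b h) <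
    +oo)%E.
    move=> kab; have [b0|bn0] := eqVneq (\int[mut]_w (bb k w)%:E)%E 0%E.
      exact: hfin.
    rewrite ltey; apply/negP => /eqP oy; move: Tfin; apply/negP; rewrite negbK.
    rewrite -leye_eq; apply: esum_ge; exists [set k].
      by split; [exact: finite_set1|move=> _ ->; left; rewrite /= in_itv].
    rewrite fsbig_set1 /T oy gt0_muley// lt0e bn0.
    exact: bb_int_ge0 bb_bound mut k.
  have [|C HC] := osc_dist_lis_app dK mhb oscf (n := `|(b + 1 - a)%R|%N);
    first by lia.
  apply: (bounded_of_dist_lis_app Om_compact f_cont leab mh (C := C)) => w.
  by have := HC w; rewrite (_ : b - _ + 1 = a)//; lia.
have r : esum S T \is a fin_num.
  have e0 : (0 <= esum S T)%E by apply: esum_ge0 => k _; exact: T0.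
  rewrite (ge0_fin_numE e0) ltey. exact: Tfin.
rewrite -(fineK r) lee_fin.
apply/ler_addgt0Pr => e e0.
have /cvgrPdist_le /(_ e e0) [N _ HN] :=
  lis_app_mean_cvg Om_compact f_cont f_uniq mu_f leab mh hM mut.
pose n := (N + `|b|)%N.
have {HN} h1 := HN n (leq_addr _ _).
have h2 : `|\int[mut]_w h w - \int[mut]_w lis_app f (- n%:Z) b h w| <= fine
  (esum S T).
  rewrite -lee_fin fineK//.
  have := telescoping dK bb_meas bb_bound mut_ft mhb hM `|(b + n%:Z + 1)%R|%N.
  rewrite (_ : b - _ + 1 = - n%:Z); last by rewrite /n; lia.
  move=> /le_trans; apply; exact: sum_le_esum bb_bound _ _ _ _ _ leab.
rewrite [leRHS]addrC
  (_ : _ - _ = (\int[mu]_w h w - \int[mut]_w lis_app f (- n%:Z) b h w)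
  - (\int[mut]_w h w - \int[mut]_w lis_app f (- n%:Z) b h w)); last by ring.
by rewrite (le_trans (ler_normB _ _))// lerD.
Qed.
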